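(* Let $H$ be a separable infinite-dimensional complex Hilbert space, let $k\in\mathbb N$, let $\mathcal T=(T_1,\dots,T_k)\in B(H)^k$ be such that $\operatorname{Int}W_e(\mathcal T)\ne\emptyset$, and let $\varepsilon>0$ and $m\in\mathbb N$ be fixed. Then there exists $\delta=\delta(k,m,\varepsilon)>0$ such that if $\{a_{nj}:n,j\in\mathbb N,\ |n-j|\le m\}\subset\mathbb C^k$ satisfies (i) $a_{nn}\in\operatorname{Int}W_e(\mathcal T)$ and $\operatorname{dist}\{a_{nn},\partial W_e(\mathcal T)\}>\varepsilon$ for all $n\in\mathbb N$; (ii) $\sup\{\|a_{nj}\|_\infty:1\le|n-j|\le m\}\le\delta$; then there is an orthonormal basis $(u_n)_{n=1}^\infty$ of $H$ such that $$\langle\mathcal Tu_j,u_n\rangle=a_{nj}\qquad\text{for all } n,j\in\mathbb N \text{ with } |n-j|\le m.$$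
   Context: $B(H)$ is the space of bounded linear operators on $H$; $\mathbb N=\{1,2,\dots\}$. For $\mathcal T=(T_1,\dots,T_k)\in B(H)^k$ and $x,y\in H$, $\langle\mathcal Tx,y\rangle=(\langle T_1x,y\rangle,\dots,\langle T_kx,y\rangle)\in\mathbb C^k$. For $\lambda\in\mathbb C^k$, $\|\lambda\|_\infty=\max\{|\lambda_1|,\dots,|\lambda_k|\}$. The (joint) essential numerical range $W_e(\mathcal T)$ is the set of all $\lambda=(\lambda_1,\dots,\lambda_k)\in\mathbb C^k$ for which there exists an orthonormal sequence $(x_n)_{n=1}^\infty\subset H$ with $\lim_{n\to\infty}\langle T_tx_n,x_n\rangle=\lambda_t$ for $t=1,\dots,k$. $\operatorname{Int}$ and $\partial$ denote interior and topological boundary in $\mathbb C^k$, and $\operatorname{dist}$ the usual distance in $\mathbb C^k$.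
   Formalization: δ is allowed to depend on H and the fixed tuple T as well as on k, m, ε; a δ depending on k, m, ε alone is impossible (already for k=m=1, diagonal T with W_e(T) a long rectangle of fixed height). *)

(* Defs.v *)
From HB Require Import structures.
From mathcomp Require Import all_boot all_order all_algebra.
From mathcomp Require Import complex.
From mathcomp Require Import all_classical all_reals all_analysis.

Set Implicit Arguments.
Unset Strict Implicit.
Unset Printing Implicit Defensive.

Import Order.TTheory GRing.Theory Num.Theory.
Import numFieldNormedType.Exports.

Local Open Scope classical_set_scope.
Local Open Scope ring_scope.

(* R[i] alone carries no topology: its regular module R[i]^o does, so C^k is
   represented by row vectors over R[i]^o, with the library's (product)
   topology. *)
Notation Cvec R k := 'rV[R[i]^o]_k.

Section ComplexSpace.
Variables (R : realType) (k : nat).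

(* `|z| for z : R[i] is again an element of R[i], with zero imaginary part. *)
Definition cmod (z : R[i]) : R := complex.Re `|z|.

Definition sup_norm (l : Cvec R k) : R := \big[Num.max/0]_(t < k) cmod (l 0 t).

Definition euclid_dist (l mu : Cvec R k) : R :=
  Num.sqrt (\sum_(t < k) cmod (l 0 t - mu 0 t) ^+ 2).

(* The infimum is extended-real valued, so that the distance to the empty set
   is +oo rather than the junk value 0. *)
Definition set_dist (l : Cvec R k) (A : set (Cvec R k)) : \bar R :=
  ereal_inf [set (euclid_dist l mu)%:E | mu in A].

End ComplexSpace.

Definition boundary (X : topologicalType) (A : set X) : set X :=
  closure A `\` interior A.

Definition separable (X : topologicalType) : Prop :=
  exists2 D : set X, countable D & dense D.

Definition infinite_dimensional (K : fieldType) (V : lmodType K) : Prop :=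
  forall (n : nat) (v : 'I_n -> V),
    exists x : V, forall c : 'I_n -> K, x <> \sum_(i < n) c i *: v i.

Section Hilbert.
Variables (R : realType) (H : completeNormedModType R[i]).
Variable dot : {dot H for Num.conj}.

(* Sequences are indexed from 0 instead of from 1. *)
Definition orthonormal_seq (x : nat -> H) : Prop :=
  forall n j : nat, dot (x n) (x j) = (n == j)%:R.

Definition lin_span (x : nat -> H) : set H :=
  [set y | exists (N : nat) (c : 'I_N -> R[i]), y = \sum_(i < N) c i *: x i].

Definition orthonormal_basis (x : nat -> H) : Prop :=
  orthonormal_seq x /\ closure (lin_span x) = setT.

(* <T x, y> as a vector of C^k; dot is linear in its first argument. *)
Definition tuple_dot (k : nat) (T : 'I_k -> {linear H -> H}) (x y : H) :
  Cvec R k := \row_(t < k) dot (T t x) y.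

Definition ess_num_range (k : nat) (T : 'I_k -> {linear H -> H}) :
  set (Cvec R k) :=
  [set l | exists2 x : nat -> H, orthonormal_seq x &
     forall t : 'I_k,
       (fun n : nat => (dot (T t (x n)) (x n) : R[i]^o)) @ \oo --> l 0 t].

End Hilbert.

(* Main.v *)
(* No convexity of the essential numerical range is used.  Call two vectors far
   apart if they are orthogonal and all forms <T_t x, v>, <x, T_t v> vanish on
   them.  If a ball around l lies in W_e, then l is the value <Tx, x> of a unit
   vector x far from any prescribed finite set: approximate the points
   l +- r e_t and l +- i r e_t along an orthonormal sequence projected onto the
   finite-codimensional space of far vectors, and remove the error by a convex
   combination whose weights solve a real linear system close to the identity.

   The basis is built one vector at a time, as u_n = b_n + x_n with b_n small
   and x_n far from everything chosen before.  The part x_n is a multiple of a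
   sum of unit vectors, mutually far and far from the past, with values
   l' +- r e_t, l' +- i r e_t, where l' is close to the required diagonal entry.
   The difference of the two vectors of such a pair is orthogonal to u_n, and
   its forms against u_n involve only the t-th coordinate: it is a handle that
   lets a later u_j receive prescribed values <T u_j, u_n> and <T u_n, u_j>.
   Separate handles are reserved for each j in n+1, .., n+m, so they do not
   interfere.  The part b_n is the sum of a small multiple of the residual of a
   target vector off the span of u_0, .., u_(n-1) and of multiples of the handles
   reserved for n, obtained from a triangular system.  The handles are
   orthogonal to the current targets, hence each visit of a target multiplies
   the square of its residual by a constant less than 1; running through a dense
   set infinitely often makes the orthonormal sequence a basis. *)

Require Import Defs.
From HB Require Import structures.
From mathcomp Require Import all_boot all_order all_algebra.
From mathcomp Require Import complex.
From mathcomp Require Import all_classical all_reals all_analysis.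
From mathcomp Require Import ring lra zify.

Import Order.TTheory GRing.Theory Num.Theory.
Import numFieldNormedType.Exports.

Local Open Scope classical_set_scope.
Local Open Scope ring_scope.
Local Open Scope complex_scope.

Set Implicit Arguments.
Unset Strict Implicit.

(** * The real-valued modulus on [R[i]] *)

Section Modulus.
Variable R : realType.
Implicit Types z w : R[i].

Lemma norm_cmod z : `|z| = (cmod z)%:C.
Proof. by rewrite /cmod normc_def. Qed.

Lemma cmod_ge0 z : 0 <= cmod z.
Proof. by rewrite -ler0c -norm_cmod. Qed.

Lemma cmodE z : cmod z = Num.sqrt (complex.Re z ^+ 2 + complex.Im z ^+ 2).
Proof. by rewrite /cmod normc_def. Qed.

Lemma cmod0 : cmod (0 : R[i]) = 0.
Proof. by rewrite /cmod normr0. Qed.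

Lemma cmod_real (r : R) : cmod (r%:C) = `|r|.
Proof. by rewrite cmodE /= expr0n addr0 sqrtr_sqr. Qed.

Lemma cmod_eq0 z : (cmod z == 0) = (z == 0).
Proof. by rewrite -(normr_eq0 z) norm_cmod fmorph_eq0. Qed.

Lemma cmodM z w : cmod (z * w) = cmod z * cmod w.
Proof. by apply: (@complexI R); rewrite rmorphM /= -!norm_cmod normrM. Qed.

Lemma cmodN z : cmod (- z) = cmod z.
Proof. by rewrite /cmod normrN. Qed.

Lemma cmodB z w : cmod (z - w) = cmod (w - z).
Proof. by rewrite -cmodN opprB. Qed.

Lemma cmodV z : cmod z^-1 = (cmod z)^-1.
Proof. by apply: (@complexI R); rewrite fmorphV /= -!norm_cmod normfV. Qed.

Lemma cmodD z w : cmod (z + w) <= cmod z + cmod w.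
Proof. by rewrite -lecR rmorphD /= -!norm_cmod ler_normD. Qed.

Lemma cmodBD z w : cmod (z - w) <= cmod z + cmod w.
Proof. by rewrite -(cmodN w) cmodD. Qed.

Lemma cmod_conj z : cmod (Num.conj z) = cmod z.
Proof. by rewrite /cmod norm_conjC. Qed.

Lemma conj_real (r : R) : Num.conj r%:C = r%:C :> R[i].
Proof. exact: conjc_real. Qed.

Lemma conjM z w : Num.conj (z * w) = Num.conj z * Num.conj w.
Proof. exact: rmorphM. Qed.

Lemma mul_conj z : z * Num.conj z = (cmod z ^+ 2)%:C.
Proof. by rewrite -normCK norm_cmod rmorphXn. Qed.

Lemma cmod_i : cmod ('i%C : R[i]) = 1.
Proof. by rewrite cmodE /= expr0n expr1n add0r sqrtr1. Qed.

Lemma conj_i : Num.conj ('i%C) = - 'i%C :> R[i].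
Proof. by rewrite complexiE conjCi. Qed.

Lemma Re_le_cmod z : `|complex.Re z| <= cmod z.
Proof. by rewrite -lecR -norm_cmod normc_ge_Re. Qed.

Lemma Im_le_cmod z : `|complex.Im z| <= cmod z.
Proof.
rewrite cmodE -sqrtr_sqr ler_wsqrtr //.
by rewrite lerDr sqr_ge0.
Qed.

End Modulus.

(** * Inner product calculus and the real-valued norm *)

Section InnerProduct.
Variables (R : realType) (H : completeNormedModType R[i]).
Variable dot : {dot H for Num.conj}.
Implicit Types (x y z : H) (c : R[i]).

Lemma dotDl x y z : dot (x + y) z = dot x z + dot y z.
Proof. exact: linearDl. Qed.

Lemma dotDr x y z : dot z (x + y) = dot z x + dot z y.
Proof. exact: linearDr. Qed.

Lemma dotZl c x z : dot (c *: x) z = c * dot x z.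
Proof. exact: linearZl_LR. Qed.

Lemma dotZr c x z : dot z (c *: x) = Num.conj c * dot z x.
Proof. exact: linearZr_LR. Qed.

Lemma dot0l z : dot 0 z = 0. Proof. exact: linear0l. Qed.
Lemma dot0r z : dot z 0 = 0. Proof. exact: linear0r. Qed.
Lemma dotNl x z : dot (- x) z = - dot x z. Proof. exact: linearNl. Qed.
Lemma dotNr x z : dot z (- x) = - dot z x. Proof. exact: linearNr. Qed.

Lemma dotBl x y z : dot (x - y) z = dot x z - dot y z.
Proof. by rewrite dotDl dotNl. Qed.

Lemma dotBr x y z : dot z (x - y) = dot z x - dot z y.
Proof. by rewrite dotDr dotNr. Qed.

Lemma dot_suml (I : Type) (s : seq I) (P : pred I) (F : I -> H) z :
  dot (\sum_(i <- s | P i) F i) z = \sum_(i <- s | P i) dot (F i) z.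
Proof. by elim/big_rec2: _ => [|i y1 y2 _ <-]; rewrite ?dot0l ?dotDl. Qed.

Lemma dot_sumr (I : Type) (s : seq I) (P : pred I) (F : I -> H) z :
  dot z (\sum_(i <- s | P i) F i) = \sum_(i <- s | P i) dot z (F i).
Proof. by elim/big_rec2: _ => [|i y1 y2 _ <-]; rewrite ?dot0r ?dotDr. Qed.

Lemma dotC x y : dot x y = Num.conj (dot y x).
Proof. by rewrite hermC /= expr0 mul1r. Qed.

Lemma dot_eq0C x y : dot x y = 0 -> dot y x = 0.
Proof. by move=> h; rewrite dotC h rmorph0. Qed.

Hypothesis dot_norm : forall x, dot x x = `|x| ^+ 2.

(** The norm of [H] takes values in [R[i]]; all estimates are made with this real version. *)
Definition nm (x : H) : R := complex.Re `|x|.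

Lemma norm_nm x : `|x| = (nm x)%:C.
Proof. by rewrite /nm RRe_real // normr_real. Qed.

Lemma nm_ge0 x : 0 <= nm x.
Proof. by rewrite -ler0c -norm_nm. Qed.

Lemma dotxx x : dot x x = (nm x ^+ 2)%:C.
Proof. by rewrite dot_norm norm_nm rmorphXn. Qed.

Lemma nm_unit x : dot x x = 1 -> nm x = 1.
Proof.
rewrite dotxx => h; have : nm x ^+ 2 = 1 by apply: (@complexI R); rewrite h.
by move/eqP; rewrite sqrp_eq1 ?nm_ge0 // => /eqP.
Qed.

Lemma nm0 : nm 0 = 0. Proof. by rewrite /nm normr0. Qed.

Lemma nm_eq0 x : (nm x == 0) = (x == 0).
Proof. by rewrite -(normr_eq0 x) norm_nm fmorph_eq0. Qed.

Lemma nmZ c x : nm (c *: x) = cmod c * nm x.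
Proof. by apply: (@complexI R); rewrite rmorphM /= -norm_nm normrZ norm_cmod
  norm_nm. Qed.

Lemma nmD x y : nm (x + y) <= nm x + nm y.
Proof. by rewrite -lecR rmorphD /= -!norm_nm ler_normD. Qed.

Lemma nmN x : nm (- x) = nm x.
Proof. by rewrite /nm normrN. Qed.

Lemma nm_sum (I : Type) (s : seq I) (P : pred I) (F : I -> H) :
  nm (\sum_(i <- s | P i) F i) <= \sum_(i <- s | P i) nm (F i).
Proof.
elim/big_rec2: _ => [|i y1 y2 _ h]; first by rewrite nm0.
by rewrite (le_trans (nmD _ _)) // lerD2l.
Qed.

(* Expand [|x - (<x,y>/|y|^2) y|^2 >= 0]. *)
Lemma cauchy_schwarz x y : cmod (dot x y) <= nm x * nm y.
Proof.
have [->|y0] := eqVneq y 0; first by rewrite dot0r cmod0 nm0 mulr0.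
have ny : 0 < nm y by rewrite lt_def nm_eq0 y0 nm_ge0.
rewrite -ler_sqr ?nnegrE ?mulr_ge0 ?nm_ge0 ?cmod_ge0 // exprMn.
pose c := dot x y / dot y y.
have : 0 <= dot (x - c *: y) (x - c *: y) by rewrite dotxx ler0c sqr_ge0.
have yy0 : dot y y != 0 by rewrite dot_norm expf_neq0 ?normr_eq0.
have e : c * dot y y = dot x y by rewrite divfK.
rewrite dotBl !dotBr !dotZl !dotZr.
set l := (X in 0 <= X); have {l} -> : l = dot x x - c * dot y x - Num.conj c *
  (dot x y - c * dot y y).
  by rewrite /l; ring.
rewrite e subrr mulr0 subr0.
rewrite /c mulrAC (dotC y x) mul_conj !dotxx -fmorphV -rmorphM -rmorphB /=
  ler0c.
by rewrite subr_ge0 ler_pdivrMr ?exprn_gt0.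
Qed.

End InnerProduct.

(** * Bounded functionals along orthonormal sequences *)

Section Functionals.
Variables (R : realType) (H : completeNormedModType R[i]).
Variable dot : {dot H for Num.conj}.
Hypothesis dot_norm : forall x, dot x x = `|x| ^+ 2.

Definition bounded_functional (f : H -> R[i]) :=
  (forall c x y, f (c *: x + y) = c * f x + f y) /\
  exists K, forall x, cmod (f x) <= K * nm x.

Lemma functional_sum (f : H -> R[i]) (I : Type) (s : seq I) (c : I -> R[i])
    (x : I -> H) :
  bounded_functional f ->
  f (\sum_(i <- s) c i *: x i) = \sum_(i <- s) c i * f (x i).
Proof.
case=> lf [K bf]; elim: s => [|i s ih]; last by rewrite !big_cons lf ih.
rewrite !big_nil; apply/eqP; rewrite -cmod_eq0 eq_le cmod_ge0 andbT.
by rewrite (le_trans (bf 0)) // nm0 mulr0.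
Qed.

(** At [v], the sum of the [conj (f (x i)) x i], both [f v] and [|v|^2] equal the partial sum [s],
    so [s <= K |v|] gives [|v| <= K]. *)
Lemma bessel (f : H -> R[i]) (x : nat -> H) :
  bounded_functional f -> orthonormal_seq dot x ->
  exists K, forall n, \sum_(0 <= i < n) cmod (f (x i)) ^+ 2 <= K.
Proof.
move=> bf ox; have [lf [K bK]] := bf; exists (K ^+ 2) => n.
set s := \sum_(0 <= i < n) _.
have s0 : 0 <= s by apply: sumr_ge0 => i _; rewrite sqr_ge0.
pose v := \sum_(0 <= i < n) Num.conj (f (x i)) *: x i.
have fv : f v = s%:C.
  rewrite functional_sum // rmorph_sum; apply: eq_bigr => i _ /=.
  by rewrite mulrC mul_conj.
have vv : dot v v = s%:C.
  rewrite {1}/v dot_suml rmorph_sum; rewrite !big_nat;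
    apply: eq_bigr => i /= hi.
  rewrite dotZl dot_sumr (bigD1_seq i) ?iota_uniq ?mem_index_iota //=.
  rewrite big1 ?addr0 => [|j ij]; last by rewrite dotZr ox eq_sym (negbTE ij)
    mulr0.
  by rewrite dotZr ox eqxx mulr1 conjCK mulrC mul_conj.
have nv : nm v ^+ 2 = s.
  by apply: (@complexI R); rewrite -(dotxx dot_norm) vv.
have [s00|sn0] := eqVneq s 0; first by rewrite s00 sqr_ge0.
have := bK v; rewrite fv cmod_real ger0_norm // => h.
have nv0 : 0 < nm v by rewrite lt_def nm_ge0 andbT -sqrf_eq0 nv.
have hK : nm v <= K by rewrite -(ler_pM2r nv0) -expr2 nv.
by rewrite -nv ler_sqr ?nnegrE ?nm_ge0 // (le_trans _ hK) ?nm_ge0.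
Qed.

(** By Bessel the squares form a convergent series, whose terms tend to zero. *)
Lemma functional_orthonormal_small (f : H -> R[i]) (x : nat -> H) (e : R) :
  bounded_functional f -> orthonormal_seq dot x -> 0 < e ->
  exists N, forall n, (N <= n)%N -> cmod (f (x n)) < e.
Proof.
move=> bf ox e0; have [K bK] := bessel bf ox.
pose u := fun i => cmod (f (x i)) ^+ 2.
have cu : cvgn (series u).
  apply: nondecreasing_is_cvgn.
    apply/nondecreasing_seqP => n; rewrite /series /= big_nat_recr //= lerDl.
    by rewrite /u sqr_ge0.
  by exists K => _ [n _ <-]; exact: bK.
have /cvgrPdist_lt /(_ (e ^+ 2)) := cvg_series_cvg_0 cu.
rewrite exprn_gt0 // => /(_ isT) [N _ hN]; exists N => n /hN /=.
by rewrite sub0r normrN ger0_norm ?sqr_ge0 // ltr_sqr ?nnegrE ?cmod_ge0 ?ltW.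
Qed.

(* A substitute for finite codimension, closed under kernels of bounded
   functionals, that needs neither Riesz representation nor adjoints. *)
Definition cofinite (P : H -> Prop) := exists p : H -> H,
  [/\ forall c x y, p (c *: x + y) = c *: p x + p y,
      exists2 K, 0 <= K & forall x, nm (p x) <= K * nm x,
      forall x, P (p x) &
      forall (x : nat -> H) (e : R), orthonormal_seq dot x -> 0 < e ->
        exists N, forall n, (N <= n)%N -> nm (p (x n) - x n) < e].

Lemma cofiniteT : cofinite (fun=> True).
Proof.
exists id; split=> //; first by exists 1 => // x; rewrite mul1r.
by move=> x e _ e0; exists 0%N => n _; rewrite subrr nm0.
Qed.

(** If [f] does not vanish on the range of [p], pick [v] with [f (p v)] nonzero and pass to
    [x |-> p (x - g x v)], where [g x = f (p x) / f (p v)]. The functional [g] is bounded, so it is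
    small along orthonormal sequences and the new map is still close to the identity there. *)
Lemma cofinite_kernel (P : H -> Prop) (f : H -> R[i]) :
  cofinite P -> bounded_functional f -> cofinite (fun x => P x /\ f x = 0).
Proof.
move=> [p [lp [K K0 bp] Pp ap]] [lf [L bL]].
have [h|/existsNP [v /eqP fv]] := pselect (forall x, f (p x) = 0).
  by exists p; split=> //; exists K.
have L0 : 0 <= L.
  rewrite leNgt; apply/negP => L0; have := bL (p v); apply/negP; rewrite -ltNge.
  apply: (lt_le_trans _ (cmod_ge0 _)).
  rewrite nmulr_rlt0 // lt_def nm_ge0 andbT nm_eq0.
  apply: contra fv => /eqP ->; rewrite -cmod_eq0 eq_le cmod_ge0 andbT.
  by rewrite (le_trans (bL 0)) // nm0 mulr0.
pose g x := f (p x) / f (p v).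
have bg : bounded_functional g.
  split; first by move=> c x y; rewrite /g lp lf; field.
  exists (L * K / cmod (f (p v))) => x; rewrite /g cmodM cmodV.
  rewrite mulrAC ler_wpM2r ?invr_ge0 ?cmod_ge0 // (le_trans (bL _)) // -mulrA.
  by rewrite ler_wpM2l.
have p'E x : p (- g x *: v + x) = - g x *: p v + p x by rewrite lp.
exists (fun x => p (- g x *: v + x)); split.
- move=> c x y; rewrite !p'E bg.1 lp scalerDr !scalerA addrACA; congr (_ + _).
  by rewrite -scalerDl; congr (_ *: _); ring.
- have [_ [G bG]] := bg.
  exists (`|G| * nm (p v) + K).
    by rewrite addr_ge0 // mulr_ge0 ?nm_ge0.
  move=> x; rewrite p'E (le_trans (nmD _ _)) // mulrDl lerD // nmZ cmodN.
  rewrite mulrAC ler_wpM2r ?nm_ge0 // (le_trans (bG _)) // ler_wpM2r ?nm_ge0 //.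
  exact: ler_norm.
- move=> x; split; first exact: Pp.
  by rewrite p'E lf /g; field.
- move=> x e ox e0; have e2 : 0 < e / 2 by rewrite divr_gt0.
  have [N1 h1] := ap x _ ox e2.
  have w0 : 0 < nm (p v) + 1 by rewrite ltr_wpDl ?nm_ge0.
  have [N2 h2] := functional_orthonormal_small bg ox (divr_gt0 e2 w0).
  exists (maxn N1 N2) => n; rewrite geq_max => /andP[/h1 a1 /h2 a2].
  rewrite p'E -addrA (le_lt_trans (nmD _ _)) // [e]splitr ltrD //.
  rewrite nmZ cmodN; move: a2; rewrite ltr_pdivlMr // mulrDr mulr1.
  by apply: le_lt_trans; rewrite lerDl cmod_ge0.
Qed.

Lemma cofinite_kernels (I : eqType) (s : seq I) (F : I -> H -> R[i])
    (P : H -> Prop) :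
  cofinite P -> (forall i, bounded_functional (F i)) ->
  cofinite (fun x => P x /\ forall i, i \in s -> F i x = 0).
Proof.
move=> cP bF; elim: s => [|i s [p [h1 h2 h3 h4]]].
  by case: cP => p [h1 h2 h3 h4]; exists p; split.
have [|q [q1 q2 q3 q4]] := @cofinite_kernel
  (fun x => P x /\ forall i, i \in s -> F i x = 0) _ _ (bF i);
    first by exists p.
exists q; split=> // x; have [[h5 h6] h7] := q3 x; split=> // j.
by rewrite inE => /predU1P[->|/h6].
Qed.

End Functionals.

(** * Far vectors and approximate values of the forms *)

Section Far.
Variables (R : realType) (H : completeNormedModType R[i]).
Variable dot : {dot H for Num.conj}.
Variables (k : nat) (T : 'I_k -> {linear H -> H}).

(** Testing [T t] on both sides makes the relation symmetric without adjoints. *)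
Definition far (x v : H) :=
  dot x v = 0 /\ forall t, dot (T t x) v = 0 /\ dot x (T t v) = 0.

Lemma far_sym x v : far x v -> far v x.
Proof.
by case=> h1 h2; split=> [|t]; [|have [h3 h4] := h2 t; split]; exact: dot_eq0C.
Qed.

Lemma far_sum (I : Type) (s : seq I) (c : I -> R[i]) (x : I -> H) v :
  (forall i, far (x i) v) -> far (\sum_(i <- s) c i *: x i) v.
Proof.
move=> hx; split=> [|t].
  by rewrite dot_suml big1 // => i _; rewrite dotZl (hx i).1 mulr0.
rewrite linear_sum !dot_suml; split; apply: big1 => i _.
  by rewrite linearZ dotZl ((hx i).2 t).1 mulr0.
by rewrite dotZl ((hx i).2 t).2 mulr0.
Qed.

Lemma farZ c x v : far x v -> far (c *: x) v.
Proof.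
move=> [x1 x2]; split=> [|t]; first by rewrite dotZl x1 mulr0.
by rewrite linearZ !dotZl (x2 t).1 (x2 t).2 !mulr0.
Qed.

Lemma farB x y v : far x v -> far y v -> far (x - y) v.
Proof.
move=> [x1 x2] [y1 y2]; split=> [|t]; first by rewrite dotBl x1 y1 subrr.
by rewrite linearB !dotBl (x2 t).1 (y2 t).1 (x2 t).2 (y2 t).2 !subrr.
Qed.

(** Vectors are picked one after another, each far from [S] and from those already picked; symmetry
    of [far] covers the other order. *)
Lemma far_family (I : finType) (Q : I -> H -> Prop) :
  (forall i (S : seq H), exists2 x, Q i x & forall v, v \in S -> far x v) ->
  forall S : seq H, exists X : I -> H,
    [/\ forall i, Q i (X i), forall i v, v \in S -> far (X i) v &
        forall i j, i != j -> far (X i) (X j)].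
Proof.
move=> hQ S.
suff [X [h1 h2 h3]] : exists X : I -> H,
    [/\ forall i, i \in enum I -> Q i (X i),
        forall i v, i \in enum I -> v \in S -> far (X i) v &
        forall i j, i \in enum I -> j \in enum I -> i != j -> far (X i) (X j)].
  by exists X; split=> *; [apply: h1|apply: h2|apply: h3]; rewrite ?mem_enum.
elim: (enum I) => [|a s [X [h1 h2 h3]]]; first by exists (fun=> 0); split.
have [as_|as_] := boolP (a \in s).
  exists X; split=> [i|i v|i j]; rewrite !inE.
  - by case/predU1P => [->|]; exact: h1.
  - by case/predU1P => [->|]; exact: h2.
  - by move=> /predU1P[->|hi] /predU1P[->|hj]; exact: h3.
have [x Qx fx] := hQ a (S ++ [seq X i | i <- s]).
have nea i : i \in s -> i != a by apply: contraTneq => ->.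
have fX i : i \in s -> far x (X i).
  by move=> hi; apply: fx; rewrite mem_cat map_f ?orbT.
exists (fun i => if i == a then x else X i); split=> [i|i v|i j]; rewrite !inE.
- by case: eqP => [->|_] //=; exact: h1.
- case: eqP => [_ _ hv|_ /= hi hv]; last exact: h2.
  by apply: fx; rewrite mem_cat hv.
- case: (i =P a) => [->|_]; case: (j =P a) => [->|_] //=.
  + by rewrite eqxx.
  + by move=> _ hj _; exact: fX.
  + by move=> hi _ _; apply/far_sym/fX.
  + exact: h3.
Qed.

(** The cross terms vanish. The map [F] is left abstract so as to cover both the identity (norms)
    and each [T t] (forms). *)
Lemma dot_far_sum (I : finType) (F : H -> H) (c : I -> R[i]) (x : I -> H) :
  (forall s (d : I -> R[i]), F (\sum_(i <- s) d i *: x i) = \sum_(i <- s) d i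
    *: F (x i)) ->
  (forall i j, i != j -> dot (F (x i)) (x j) = 0) ->
  dot (F (\sum_i c i *: x i)) (\sum_i c i *: x i)
    = \sum_i (cmod (c i) ^+ 2)%:C * dot (F (x i)) (x i).
Proof.
move=> lF hF; rewrite lF dot_suml; apply: eq_bigr => i _.
rewrite dotZl dot_sumr (bigD1 i) //= big1 ?addr0 => [|j ji].
  by rewrite dotZr mulrA mul_conj.
by rewrite dotZr hF ?mulr0 // eq_sym.
Qed.

Lemma far_sum_norm (I : finType) (c : I -> R[i]) (x : I -> H) :
  (forall i, dot (x i) (x i) = 1) -> (forall i j, i != j -> far (x i) (x j)) ->
  dot (\sum_i c i *: x i) (\sum_i c i *: x i) = (\sum_i cmod (c i) ^+ 2)%:C.
Proof.
move=> x1 fx; rewrite (@dot_far_sum I id) // => [|i j /fx []//].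
by rewrite rmorph_sum; apply: eq_bigr => i _; rewrite x1 mulr1.
Qed.

Lemma far_sum_form (I : finType) (c : I -> R[i]) (x : I -> H) t :
  (forall i j, i != j -> far (x i) (x j)) ->
  dot (T t (\sum_i c i *: x i)) (\sum_i c i *: x i)
    = \sum_i (cmod (c i) ^+ 2)%:C * dot (T t (x i)) (x i).
Proof.
move=> fx; apply: dot_far_sum => [s d|i j /fx [_ /(_ t)] []//].
by rewrite linear_sum; apply: eq_bigr => i _; rewrite linearZ.
Qed.

Hypothesis dot_norm : forall x, dot x x = `|x| ^+ 2.
Variable M : R.
Hypothesis M_ge0 : 0 <= M.
Hypothesis T_le : forall t x, nm (T t x) <= M * nm x.

Lemma form_le t x y : cmod (dot (T t x) y) <= M * nm x * nm y.
Proof.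
by rewrite (le_trans (cauchy_schwarz dot_norm _ _)) // ler_wpM2r ?nm_ge0.
Qed.

(** Being far from a finite list means lying in the kernels of finitely many bounded functionals, of
    three types. *)
Lemma far_cofinite (S : seq H) :
  cofinite dot (fun x => forall v, v \in S -> far x v).
Proof.
have b1 v : bounded_functional (fun x => dot x v).
  split=> [c x y|]; first by rewrite dotDl dotZl.
  by exists (nm v) => x; rewrite mulrC; exact: cauchy_schwarz.
have b2 (vt : H * 'I_k) : bounded_functional (fun x => dot (T vt.2 x) vt.1).
  split=> [c x y|]; first by rewrite linearP dotDl dotZl.
  by exists (M * nm vt.1) => x; rewrite mulrAC; exact: form_le.
have s1 := cofinite_kernels dot_norm S (cofiniteT dot) b1.
pose s := [seq (v, t) | v <- S, t <- enum 'I_k].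
have s2 := cofinite_kernels dot_norm s s1 (fun vt => b1 (T vt.2 vt.1)).
have [p [h1 h2 h3 h4]] := cofinite_kernels dot_norm s s2 b2.
exists p; split=> // x v vS.
have [[[_ a1] a2] a3] := h3 x; split; first exact: a1.
by move=> t; split; [apply: (a3 (v, t))|apply: (a2 (v, t))];
   apply/allpairsP; exists (v, t); rewrite mem_enum.
Qed.

(** Passing from [x] to [y] and rescaling [y] to norm one each cost at most [3 M e]. *)
Lemma form_normalize (x y : H) (e : R) t : dot x x = 1 -> nm (y - x) < e ->
  e <= 1 / 2 ->
  cmod ((nm y ^- 2)%:C * dot (T t y) y - dot (T t x) x) <= 6 * M * e.
Proof.
move=> x1 ye e2; have nx := nm_unit dot_norm x1.
set d := y - x in ye; have yE : y = x + d by rewrite /d addrC subrK.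
have d0 := nm_ge0 d.
have y_le : nm y <= 1 + e by rewrite yE (le_trans (nmD _ _)) // nx lerD2l ltW.
have y_ge : 1 - e <= nm y.
  have := nmD y (- d); rewrite nmN {1}yE addrK nx; lra.
have y0 : 0 < nm y by lra.
set a := dot (T t y) y.
have a_le : cmod a <= M * nm y ^+ 2 by rewrite expr2 mulrA form_le.
have s1 : cmod (a - dot (T t x) x) <= 3 * M * e.
  have -> : a - dot (T t x) x = dot (T t d) y + dot (T t x) d.
    rewrite /a {1}yE linearD dotDl {1}yE dotDr; ring.
  rewrite (le_trans (cmodD _ _)) // (le_trans (lerD (form_le _ _ _) (form_le _
    _ _))) //.
  have h1 : M * nm d <= M * e by rewrite ler_wpM2l // ltW.
  have h2 : M * nm d * nm y <= M * e * 2 by rewrite ler_pM ?mulr_ge0 ?nm_ge0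
    //; lra.
  rewrite nx mulr1; lra.
have s2 : cmod ((nm y ^- 2)%:C * a - a) <= 3 * M * e.
  have -> : (nm y ^- 2)%:C * a - a = (nm y ^- 2 * (1 - nm y ^+ 2))%:C * a.
    rewrite mulrBr mulr1 mulVf ?expf_neq0 ?gt_eqF // rmorphB /=; ring.
  rewrite cmodM cmod_real normrM ger0_norm ?invr_ge0 ?sqr_ge0 //.
  have -> : 3 * M * e = nm y ^- 2 * (3 * e) * (M * nm y ^+ 2).
    by field; rewrite gt_eqF.
  rewrite ler_pM ?cmod_ge0 ?mulr_ge0 ?invr_ge0 ?sqr_ge0 //.
  rewrite ler_wpM2l ?invr_ge0 ?sqr_ge0 // ler_norml; apply/andP; split; nra.
rewrite -(subrK a (_ * a)) -addrA (le_trans (cmodD _ _)) //; lra.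
Qed.

(** A late term of the orthonormal sequence for [l] is moved into the space of far vectors by [p],
    which displaces it by less than [d], and is then normalized. *)
Lemma ess_num_range_approx (l : Cvec R k) (S : seq H) (e : R) :
  ess_num_range dot T l -> 0 < e ->
  exists x, [/\ dot x x = 1, forall v, v \in S -> far x v &
    forall t, cmod (dot (T t x) x - l 0 t) < e].
Proof.
move=> [x ox cx] e0.
have M1 : 0 < 12 * M + 1 by rewrite ltr_wpDl ?mulr_ge0.
(* Chosen so that normalization costs at most [e / 2]; the [+ 1] allows [M = 0]. *)
pose d := Num.min (1 / 2) (e / 2 / (12 * M + 1)).
have d0 : 0 < d by rewrite lt_min !divr_gt0.
have d2 : d <= 1 / 2 by rewrite ge_min lexx.
have Md : 6 * M * d <= e / 2.
  have h : d <= e / 2 / (12 * M + 1) by rewrite ge_min lexx orbT.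
  move: h; rewrite ler_pdivlMr // => h; nra.
have [p [_ _ pS ap]] := far_cofinite S.
have [N hN] := ap x d ox d0.
have [N' hN'] : exists N, forall n t, (N <= n)%N ->
    cmod (dot (T t (x n)) (x n) - l 0 t) < e / 2.
  have h t : exists N, forall n, (N <= n)%N ->
      cmod (dot (T t (x n)) (x n) - l 0 t) < e / 2.
    have /cvgrPdist_lt/(_ (e / 2)%:C) := cx t.
    rewrite ltcR divr_gt0 // => /(_ isT) [N' _ h]; exists N' => n /h /=.
    by rewrite norm_cmod ltcR cmodB.
  have [F hF] := choice h; exists (\max_t F t)%N => n t hn; apply: hF.
  exact: leq_trans (leq_bigmax t) hn.
pose n := maxn N N'; have := hN n (leq_maxl _ _);
  have hl t := hN' n t (leq_maxr _ _).
set y := p (x n) => hy; have x1 : dot (x n) (x n) = 1 by rewrite ox eqxx.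
have y0 : 0 < nm y.
  by have := nmD y (x n - y); rewrite subrKC (nm_unit dot_norm x1) -(nmN (x n -
    y)) opprB; lra.
have yy : nm y ^+ 2 != 0 by rewrite expf_neq0 ?gt_eqF.
exists ((nm y)^-1%:C *: y); split.
- rewrite dotZl dotZr conj_real dotxx // mulrA -!rmorphM /= -invfM -expr2.
  by rewrite mulVf.
- by move=> v vS; apply/farZ/pS.
- move=> t; rewrite [T t (_ *: _)]linearZ dotZl dotZr conj_real mulrA -rmorphM
    /= -invfM -expr2.
  rewrite -(subrK (dot (T t (x n)) (x n)) (_ * _)) -addrA (le_lt_trans (cmodD _
    _)) //.
  rewrite [e]splitr ler_ltD // (le_trans (form_normalize _ x1 hy d2)) //.
Qed.

End Far.

(** * Real linear systems close to the identity *)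

Section NearIdentity.
Variables (R : realType) (I : finType).
Implicit Types (A : I -> I -> R) (v b : I -> R).

(** In the row where [|v|] is maximal, the deviation of [A] from the identity contributes at most
    half of that maximum. *)
Lemma near_identity_bound A v (B e : R) :
  (forall i j, `|A i j - (i == j)%:R| <= e) -> e * #|I|%:R <= 1 / 2 ->
  (forall i, `|\sum_j A i j * v j| <= B) -> forall i, `|v i| <= 2 * B.
Proof.
move=> hA he hB i.
pose m := [arg max_(j > i) `|v j|]%O.
have hm j : `|v j| <= `|v m|.
  by rewrite /m; case: (@arg_maxP _ R _ i xpredT (fun j => `|v j|)) => // m' _;
    exact.
apply: le_trans (hm i) _.
have e1 : v m = \sum_j A m j * v j - \sum_j (A m j - (m == j)%:R) * v j.
  rewrite -sumrB (bigD1 m) //= big1 ?addr0 => [|j jm].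
    by rewrite eqxx -mulrBl subKr mul1r.
  by rewrite eq_sym (negbTE jm) subr0 subrr.
have : `|v m| <= B + e * #|I|%:R * `|v m|.
  rewrite {1}e1 (le_trans (ler_normB _ _)) // lerD //.
  rewrite (le_trans (ler_norm_sum _ _ _)) //.
  have -> : e * #|I|%:R * `|v m| = \sum_(j : I) e * `|v m|.
    by rewrite sumr_const -mulr_natr; ring.
  by apply: ler_sum => j _; rewrite normrM ler_pM.
have := normr_ge0 (v m); nra.
Qed.

Lemma near_identity_system A b (B e : R) :
  (forall i j, `|A i j - (i == j)%:R| <= e) -> e * #|I|%:R <= 1 / 2 ->
  (forall i, `|b i| <= B) ->
  exists v : I -> R, (forall i, \sum_j A i j * v j = b i) /\
    forall i, `|v i| <= 2 * B.
Proof.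
move=> hA he hB.
(* Transposed, because row vectors are multiplied from the left. *)
pose Mx := \matrix_(i, j < #|I|) A (enum_val j) (enum_val i).
have sumE (w : 'rV[R]_#|I|) j :
    (w *m Mx) 0 j = \sum_i A (enum_val j) i * w 0 (enum_rank i).
  rewrite mxE [RHS](reindex (fun i : 'I_#|I| => enum_val i)) /=;
    last exact/onW_bij/enum_val_bij.
  by apply: eq_bigr => i _; rewrite !mxE enum_valK mulrC.
have uM : Mx \in unitmx.
  (* The a priori bound with [B = 0] shows that the kernel is trivial. *)
  rewrite unitmxE unitfE; apply/negP => /det0P [w w0 wM]; move/negP: w0; apply.
  apply/eqP/rowP => j; rewrite [RHS]mxE; apply/eqP; rewrite -normr_le0.
  rewrite -(mulr0 2) -(enum_valK j).
  apply: (near_identity_bound (v := fun i => w 0 (enum_rank i)) hA he) => i.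
  by have := sumE w (enum_rank i); rewrite wM mxE enum_rankK => <-;
    rewrite normr0.
pose w := (\row_j b (enum_val j)) *m invmx Mx.
have hv i : \sum_j A i j * w 0 (enum_rank j) = b i.
  by rewrite -[in LHS](enum_rankK i) -sumE mulmxKV // mxE enum_rankK.
exists (fun i => w 0 (enum_rank i)); split=> // i.
by apply: (near_identity_bound (v := fun i => w 0 (enum_rank i)) hA he) => j;
  rewrite hv.
Qed.

End NearIdentity.

(** * Real coordinates of complex numbers *)

Section Parts.
Variable R : realType.
Implicit Types (c : bool) (z w : R[i]).

Definition part c z : R := if c then complex.Im z else complex.Re z.
Definition imunit c : R[i] := if c then 'i else 1.

Lemma partD c z w : part c (z + w) = part c z + part c w.
Proof. by case: c z w => -[a b] [a' b']. Qed.

Lemma partN c z : part c (- z) = - part c z.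
Proof. by case: c z => -[a b]. Qed.

Lemma partZ c (r : R) z : part c (r%:C * z) = r * part c z.
Proof. by case: c z => -[a b] /=; rewrite !mul0r ?subr0 ?addr0. Qed.

Lemma part0 c : part c 0 = 0.
Proof. by case: c. Qed.

Lemma part_sum c (I : Type) (s : seq I) (F : I -> R[i]) :
  part c (\sum_(i <- s) F i) = \sum_(i <- s) part c (F i).
Proof. by elim/big_rec2: _ => [|i y1 y2 _ <-]; rewrite ?part0 ?partD. Qed.

Lemma part_imunit c c' : part c (imunit c') = (c == c')%:R.
Proof. by case: c c' => -[]. Qed.

Lemma part_le c z : `|part c z| <= cmod z.
Proof. by case: c; [exact: Im_le_cmod|exact: Re_le_cmod]. Qed.

Lemma part_eq0 z : (forall c, part c z = 0) -> z = 0.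
Proof.
by case: z => a b h; have := h false; have := h true => /= -> ->.
Qed.

Lemma cmod_imunit c : cmod (imunit c) = 1.
Proof. by case: c; [exact: cmod_i|rewrite /cmod normr1]. Qed.

End Parts.

Lemma sum_pair_bool (V : nmodType) (I : finType) (F : I * bool -> V) :
  \sum_p F p = \sum_i (F (i, true) + F (i, false)).
Proof.
rewrite (eq_bigr (fun p => F (p.1, p.2))) => [|[i b] _] //.
by rewrite -(pair_bigA _ (fun i b => F (i, b))); apply: eq_bigr => i _;
  rewrite big_bool.
Qed.

(** * Exact values at points well inside the essential numerical range *)

Section Exact.
Variables (R : realType) (k : nat).

(** The index [j] is one of the [2 k] real directions of [C^k]; the sign is carried by [r]. *)
Definition offset (l : Cvec R k) (r : R) (j : 'I_k * bool) : Cvec R k :=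
  \row_t (l 0 t + r%:C * ((t == j.1)%:R * imunit R j.2)).

Lemma offset_dist l r j t : cmod (offset l r j 0 t - l 0 t) <= `|r|.
Proof.
rewrite mxE addrC addKr cmodM cmod_real; case: eqP => _.
  by rewrite mul1r cmod_imunit mulr1.
by rewrite mul0r cmod0 mulr0.
Qed.

Variables (H : completeNormedModType R[i]) (dot : {dot H for Num.conj}).
Variable T : 'I_k -> {linear H -> H}.

(** The open ball of radius [r] in the maximum norm lies in the essential numerical range. *)
Definition good (r : R) (l : Cvec R k) :=
  forall mu : Cvec R k, (forall t, cmod (mu 0 t - l 0 t) < r) ->
    ess_num_range dot T mu.

Hypothesis dot_norm : forall x, dot x x = `|x| ^+ 2.
Variable M : R.
Hypothesis M_ge0 : 0 <= M.
Hypothesis T_le : forall t x, nm (T t x) <= M * nm x.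
Hypothesis k_gt0 : (0 < k)%N.

(** Mutually far unit vectors approximate the offsets of [l] in all signed directions. Combined with
    square roots of convex weights as coefficients, they form a unit vector whose value is the
    weighted mean of theirs; the weights are tuned to make this mean equal to [l]. *)
Lemma exact_value (l : Cvec R k) (r : R) (S : seq H) : 0 < r -> good r l ->
  exists x, [/\ dot x x = 1, forall v, v \in S -> far dot T x v &
    forall t, dot (T t x) x = l 0 t].
Proof.
move=> r0 gl; pose J : finType := ('I_k * bool)%type.
pose d : R := #|J|%:R.
have d0 : 0 < d by rewrite ltr0n; apply/card_gt0P; exists (Ordinal k_gt0, true).
pose h := r / 2; have h0 : 0 < h by rewrite divr_gt0.
(* With [d] directions this makes the system deviate from the identity by [e / h = 1 / (2 d)] per
   entry, and its right-hand side at most [1 / 2]. *)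
pose e := h / (2 * d); have e0 : 0 < e by rewrite divr_gt0 ?mulr_gt0.
pose sg (b : bool) : R := if b then h else - h.
have pick p (S' : seq H) : exists2 x, dot x x = 1 /\
    (forall t, cmod (dot (T t x) x - offset l (sg p.2) p.1 0 t) < e) &
    forall v, v \in S' -> far dot T x v.
  have hW : ess_num_range dot T (offset l (sg p.2) p.1).
    apply: gl => t; apply: le_lt_trans (offset_dist _ _ _ _) _.
    have -> : `|sg p.2| = h by rewrite /sg; case: ifP;
      rewrite ?normrN gtr0_norm.
    rewrite /h; lra.
  have [x [x1 x2 x3]] := ess_num_range_approx dot_norm M_ge0 T_le S' hW e0.
  by exists x.
have [X [X1 X2 X3]] := @far_family R H dot k T (J * bool)%type _ pick S.
pose q p t := dot (T t (X p)) (X p).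
pose err j s t := q (j, s) t - offset l (sg s) j 0 t.
pose D j s t := q (j, s) t - l 0 t.
have DE j s t : D j s t = (sg s)%:C * ((t == j.1)%:R * imunit R j.2) + err j s
  t.
  by rewrite /D /err mxE opprD addrA [RHS]addrC addrACA; ring.
have err_le c j s t : `|part c (err j s t)| <= e.
  by rewrite (le_trans (part_le _ _)) // ltW // (X1 (j, s)).2.
(* Rows are real coordinates of the error, columns are directions; without approximation error [A]
   would be the identity and [b] zero. *)
pose A (i j : J) := part i.2 (D j true i.1 - D j false i.1) / (2 * h).
pose b (i : J) := - (\sum_j part i.2 (D j true i.1 + D j false i.1)) / (2 * h).
have h20 : 0 < 2 * h by rewrite mulr_gt0.
have i20 : 0 <= (2 * h)^-1 by rewrite invr_ge0 ltW.
have deltaE (i j : J) : part i.2 ((i.1 == j.1)%:R * imunit R j.2) = (i == j)%:R.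
  case: i j => [i ci] [j cj] /=; rewrite -pair_eqE /pair_eq /=; case: eqP => _.
    by rewrite mul1r part_imunit.
  by rewrite mul0r part0.
have hA i j : `|A i j - (i == j)%:R| <= e / h.
  rewrite /A !DE /sg.
  have -> : part i.2 (h%:C * ((i.1 == j.1)%:R * imunit R j.2) + err j true i.1 -
     ((- h)%:C * ((i.1 == j.1)%:R * imunit R j.2) + err j false i.1)) =
     2 * h * (i == j)%:R + (part i.2 (err j true i.1) - part i.2 (err j false
       i.1)).
    by rewrite !(partD, partN, partZ) deltaE; ring.
  have -> : forall y z : R, (2 * h * y + z) / (2 * h) - y = z / (2 * h).
    by move=> y z; field; rewrite gt_eqF.
  rewrite normrM (ger0_norm i20) ler_pdivrMr //.
  have -> : e / h * (2 * h) = e + e by field; rewrite gt_eqF.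
  by rewrite (le_trans (ler_normB _ _)) // lerD.
have hAd : e / h * #|J|%:R <= 1 / 2.
  by rewrite -/d /e (_ : _ * _ = 1 / 2) //; field; rewrite !gt_eqF.
have hb i : `|b i| <= 1 / 2.
  rewrite /b mulNr normrN normrM (ger0_norm i20).
  rewrite ler_pdivrMr // (le_trans (ler_norm_sum _ _ _)) //.
  have -> : 1 / 2 * (2 * h) = \sum_(j : J) (e + e).
    rewrite sumr_const -mulr_natr -/d /e; field; rewrite gt_eqF //.
  apply: ler_sum => j _; rewrite !DE /sg.
  have -> : h%:C * ((i.1 == j.1)%:R * imunit R j.2) + err j true i.1 +
     ((- h)%:C * ((i.1 == j.1)%:R * imunit R j.2) + err j false i.1) =
     err j true i.1 + err j false i.1 by rewrite rmorphN /=; ring.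
  by rewrite partD (le_trans (ler_normD _ _)) // lerD.
have [v [hv]] := near_identity_system hA hAd hb; rewrite mul1r mulfV // => v1.
(* Since [|v| <= 1] the weights are nonnegative, and opposite signs cancel to give total weight
   one. *)
pose th (p : J * bool) := (1 + (if p.2 then v p.1 else - v p.1)) / (2 * d).
have d20 : 0 < 2 * d by rewrite mulr_gt0.
have th0 p : 0 <= th p.
  rewrite divr_ge0 ?(ltW d20) //; have := v1 p.1;
    rewrite ler_norml => /andP[? ?].
  by case: ifP => _; lra.
pose c p := (Num.sqrt (th p))%:C.
have cE p : cmod (c p) ^+ 2 = th p.
  by rewrite cmod_real ger0_norm ?sqrtr_ge0 // sqr_sqrtr.
have sth : \sum_p th p = 1.
  rewrite sum_pair_bool /th /= (eq_bigr (fun=> d^-1)) => [|j _].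
    by rewrite sumr_const -mulr_natr mulVf ?gt_eqF.
  by field; rewrite gt_eqF.
exists (\sum_p c p *: X p); split.
- rewrite (far_sum_norm (T := T)) // => [|p]; last exact: (X1 p).1.
  by rewrite (eq_bigr th) ?sth // => p _; exact: cE.
- by move=> w wS; apply: far_sum => p; exact: X2.
- move=> t; rewrite far_sum_form //.
  have -> : \sum_p (cmod (c p) ^+ 2)%:C * dot (T t (X p)) (X p) =
      \sum_p (th p)%:C * D p.1 p.2 t + l 0 t.
    rewrite -[X in _ + X]mul1r -[1](rmorph1 (real_complex R)) -sth rmorph_sum.
    rewrite mulr_suml -big_split; apply: eq_bigr => -[j s] _ /=.
    by rewrite cE -mulrDr subrK.
  rewrite -[RHS]add0r; congr (_ + _); apply: part_eq0 => c'; rewrite part_sum.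
  rewrite (eq_bigr (fun p => th p * part c' (D p.1 p.2 t)));
    last by move=> p _; rewrite partZ.
  rewrite sum_pair_bool /th /=.
  have hvi := hv (t, c'); rewrite /A /b /= in hvi.
  (* The weighted error is [h / d] times the defect of the system solved by [v]. *)
  transitivity ((2 * h) / (2 * d) * (\sum_j part c' (D j true t - D j false t)
    / (2 * h) * v j
    + (\sum_j part c' (D j true t + D j false t)) / (2 * h))).
    rewrite mulrDr mulr_suml !mulr_sumr -big_split /=; apply: eq_bigr => j _.
    by rewrite !(partD, partN); field; rewrite !gt_eqF.
  by rewrite hvi mulNr addNr mulr0.
Qed.

End Exact.

(** * From distance to the boundary to balls inside the set *)

Section Segment.
Variables (R : realType) (k : nat).

Lemma segment_nbhs (l mu : Cvec R k) (s : R) (U : set (Cvec R k)) :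
  let g s := \row_t (l 0 t + s%:C * (mu 0 t - l 0 t)) : Cvec R k in
  nbhs (g s) U -> exists2 d, 0 < d & forall s', `|s' - s| < d -> U (g s').
Proof.
move=> g /nbhs_ballP [e /= e0 he].
have eE : e = (complex.Re e)%:C by rewrite RRe_real // gtr0_real.
have e'0 : 0 < complex.Re e by rewrite -ltcR -eE.
pose K := 1 + \sum_t cmod (mu 0 t - l 0 t).
have K0 : 0 < K by rewrite ltr_pwDl // sumr_ge0 // => t _; exact: cmod_ge0.
exists (complex.Re e / K); first by rewrite divr_gt0.
move=> s' hs'; apply: he; split=> // i t; rewrite ord1 !mxE /ball /=.
have -> : l 0 t + s%:C * (mu 0 t - l 0 t) - (l 0 t + s'%:C * (mu 0 t - l 0 t)) =
   (s - s')%:C * (mu 0 t - l 0 t) by rewrite rmorphB /=; ring.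
rewrite norm_cmod eE ltcR cmodM cmod_real distrC.
have hK : cmod (mu 0 t - l 0 t) <= K.
  rewrite /K (bigD1 t) //= addrCA lerDl addr_ge0 // sumr_ge0 // => j _.
  exact: cmod_ge0.
rewrite (le_lt_trans (ler_wpM2l (normr_ge0 _) hK)) //.
by rewrite -ltr_pdivlMr.
Qed.

(** The sharp factor is the square root of [k]; the cruder [k] suffices. *)
Lemma euclid_dist_le (l mu : Cvec R k) (r : R) :
  (forall t, cmod (l 0 t - mu 0 t) <= r) -> euclid_dist l mu <= k%:R * r.
Proof.
move=> h; case: (posnP k) => [k0|k0].
  rewrite /euclid_dist big1 ?sqrtr0 ?k0 ?mul0r // => t.
  by have := ltn_ord t; rewrite {2}k0.
have r0 : 0 <= r := le_trans (cmod_ge0 _) (h (Ordinal k0)).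
rewrite -[leRHS]ger0_norm ?mulr_ge0 // -sqrtr_sqr ler_wsqrtr // exprMn.
apply: (@le_trans _ _ (\sum_(t < k) r ^+ 2)).
  by apply: ler_sum => t _; rewrite ler_sqr ?nnegrE ?cmod_ge0.
rewrite sumr_const card_ord -[leLHS]mulr_natl ler_wpM2r ?sqr_ge0 //.
by rewrite -natrX ler_nat; exact: (leq_pexp2l k0 (isT : 1 <= 2)%N).
Qed.

(* The segment from l to a point outside W would leave the interior of W
   through the boundary. *)
Lemma ball_sub_of_dist_boundary (W : set (Cvec R k)) (l mu : Cvec R k)
    (eps r : R) :
  interior W l -> (eps%:E < set_dist l (boundary W))%E -> k%:R * r <= eps ->
  (forall t, cmod (mu 0 t - l 0 t) < r) -> W mu.
Proof.
move=> Wl dl kr hmu; apply: contrapT => nW.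
pose g (s : R) : Cvec R k := \row_t (l 0 t + s%:C * (mu 0 t - l 0 t)).
have g0 : g 0 = l by apply/rowP => t; rewrite mxE mul0r addr0.
have g1 : g 1 = mu by apply/rowP => t; rewrite mxE mul1r subrKC.
pose E := [set s : R | [/\ 0 <= s, s <= 1 & interior W (g s)]].
have E0 : E 0 by rewrite /E /= g0 lexx ler01.
have ubE : ubound E 1 by move=> s [].
have sE : has_sup E by split; [exists 0|exists 1].
pose s0 := sup E.
have s00 : 0 <= s0 by apply: ub_le_sup => //; exists 1.
have s01 : s0 <= 1 by apply: ge_sup => //; exists 0.
have bd : boundary W (g s0).
  split.
    move=> U /segment_nbhs [d d0 hd].
    have [s Es hs] := sup_adherent d0 sE.
    exists (g s); split; first by case: Es => _ _; exact: interior_subset.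
    apply: hd; rewrite distrC ger0_norm ?subr_ge0;
      first by rewrite ltrBlDl -ltrBlDr.
    by apply: ub_le_sup Es; exists 1.
  move=> Wg; have [s1|s1] := eqVneq s0 1.
    by apply: nW; rewrite -g1 -s1; exact: interior_subset.
  have {}s1 : s0 < 1 by rewrite lt_def eq_sym s1.
  have [d d0 hd] : exists2 d, 0 < d & forall s, `|s - s0| < d -> interior W (g
    s).
    by apply: segment_nbhs; apply: open_nbhs_nbhs; split=> //;
      exact: open_interior.
  (* If [g s0] were interior, this larger parameter would still belong to [E]. *)
  pose s := Num.min 1 (s0 + d / 2).
  have ss0 : s0 < s by rewrite lt_min s1 ltrDl divr_gt0.
  have sd : s <= s0 + d / 2 by rewrite ge_min lexx orbT.
  suff : s <= s0 by rewrite leNgt ss0.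
  apply: ub_le_sup; first by exists 1.
  split; [by rewrite (le_trans s00) // ltW|by rewrite ge_min lexx|].
  by apply: hd; rewrite gtr0_norm ?subr_gt0 //; lra.
have : (set_dist l (boundary W) <= (euclid_dist l (g s0))%:E)%E.
  by apply: ereal_inf_lbound; exists (g s0).
apply/negP; rewrite -ltNge; apply: le_lt_trans dl; rewrite lee_fin.
apply: le_trans kr; apply: euclid_dist_le => t; rewrite cmodB mxE addrC addKr.
rewrite cmodM cmod_real ger0_norm // -[r]mul1r.
by rewrite ler_pM ?cmod_ge0 // ltW.
Qed.

End Segment.

(** * One step: a new vector together with its handles *)

Section Step.
Variables (R : realType) (H : completeNormedModType R[i]).
Variables (dot : {dot H for Num.conj}) (k : nat) (T : 'I_k -> {linear H -> H}).
Hypothesis dot_norm : forall x, dot x x = `|x| ^+ 2.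
Variable M : R.
Hypothesis M_ge0 : 0 <= M.
Hypothesis T_le : forall t x, nm (T t x) <= M * nm x.
Hypothesis k_gt0 : (0 < k)%N.
Variable m : nat.
Hypothesis m_gt0 : (0 < m)%N.

Lemma good_near (r s : R) (l mu : Cvec R k) : good dot T r l ->
  (forall t, cmod (mu 0 t - l 0 t) <= s) -> good dot T (r - s) mu.
Proof.
move=> gl hs nu hnu; apply: gl => t.
rewrite -(subrK (mu 0 t) (nu 0 t)) -addrA (le_lt_trans (cmodD _ _)) //.
have := hnu t; have := hs t; lra.
Qed.

(** The point [l] is the value of a unit vector, and the operators are bounded by [M]. *)
Lemma good_le (r : R) (l : Cvec R k) t : 0 < r -> good dot T r l ->
  cmod (l 0 t) <= M.
Proof.
move=> r0 gl.
have [x [x1 _ <-]] := exact_value dot_norm M_ge0 T_le k_gt0 [::] r0 gl.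
by rewrite (le_trans (form_le dot_norm T_le _ _ _)) // !(nm_unit dot_norm x1)
  !mulr1.
Qed.

(** The far part of the new vector has squared norm [1 - |b|^2], so its mean value must be this [l']
    for the diagonal entry to come out as [l]. Its distance to [l] is at most
    [4 M |b|^2 <= r / 4]. *)
Lemma corrected_center (r : R) (l : Cvec R k) (b : H) : 0 < r -> good dot T r l
  ->
  nm b ^+ 2 <= 1 / 2 -> 16 * M * nm b ^+ 2 <= r ->
  exists2 l' : Cvec R k, good dot T (r - r / 4) l' &
    forall t, (1 - nm b ^+ 2)%:C * l' 0 t = l 0 t - dot (T t b) b.
Proof.
move=> r0 gl b2 bM; set c := 1 - nm b ^+ 2.
have c2 : 1 / 2 <= c by rewrite /c; lra.
have c0 : 0 < c by lra.
have cC : c%:C != 0 :> R[i] by rewrite fmorph_eq0 gt_eqF.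
exists (\row_t (c%:C^-1 * (l 0 t - dot (T t b) b))); last first.
  by move=> t; rewrite mxE mulVKf.
apply: (good_near gl) => t; rewrite mxE.
have -> : c%:C^-1 * (l 0 t - dot (T t b) b) - l 0 t =
    c%:C^-1 * ((nm b ^+ 2)%:C * l 0 t - dot (T t b) b).
  apply: (mulfI cC); rewrite mulrBr !mulVKf // /c rmorphB /= rmorph1; ring.
rewrite cmodM cmodV cmod_real (gtr0_norm c0) mulrC ler_pdivrMr //.
apply: (@le_trans _ _ (2 * M * nm b ^+ 2)); last by nra.
rewrite (le_trans (cmodBD _ _)) // cmodM cmod_real (ger0_norm (sqr_ge0 _)).
have h1 := good_le t r0 gl; have h2 := form_le dot_norm T_le t b b.
have h3 := sqr_ge0 (nm b); have h4 : nm b ^+ 2 * cmod (l 0 t) <= nm b ^+ 2 * M.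
  by rewrite ler_wpM2l.
lra.
Qed.

Lemma dot_far_member (I : finType) (F G : H -> H) (c : I -> R[i]) (x : I -> H)
  p :
  (forall i, i != p -> dot (F (x p)) (G (x i)) = 0) ->
  dot (F (x p)) (\sum_i c i *: G (x i)) = Num.conj (c p) * dot (F (x p)) (G (x
    p)).
Proof.
move=> h; rewrite dot_sumr (bigD1 p) //= big1 ?addr0 ?dotZr // => i ip.
by rewrite dotZr h ?mulr0.
Qed.

(** The lower bound [w0] for the gain comes before [l], [b] and [S], hence is uniform over all
    steps. The vector [b] is the prescribed small part of [u], and [z q] is the set of handles kept
    for one of the [m] following steps. *)
Definition extendable (r w0 : R) := forall (l : Cvec R k) (b : H) (S : seq H),
  good dot T r l ->
  nm b ^+ 2 <= 1 / 2 -> 16 * M * nm b ^+ 2 <= r ->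
  exists (u : H) (z : 'I_m -> 'I_k * bool -> H) (w : R),
  [/\ w0 <= w,
      dot u u = 1 /\ forall t, dot (T t u) u = l 0 t,
      forall v, v \in b :: S -> far dot T (u - b) v,
      forall q j v, v \in b :: S -> far dot T (z q j) v &
      [/\ forall q j, dot (z q j) u = 0,
          forall q j, nm (z q j) <= 2,
          forall q j q' j', q != q' -> dot (z q j) (z q' j') = 0,
          forall q j t, dot (T t (z q j)) u = w%:C * ((t == j.1)%:R * imunit R
            j.2) &
          forall q j t, dot (T t u) (z q j) = w%:C * ((t == j.1)%:R * imunit R
            j.2)]].

Lemma extendable_ex (r : R) : 0 < r -> exists2 w0, 0 < w0 & extendable r w0.
Proof.
move=> r0; pose J : finType := ('I_m * ('I_k * bool))%type.
pose n2 : R := #|J|%:R; pose h := r / 4.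
have h0 : 0 < h by rewrite divr_gt0.
have n20 : 0 < n2.
  by rewrite ltr0n; apply/card_gt0P; exists (Ordinal m_gt0, (Ordinal k_gt0,
    true)).
have n21 : 0 < 1 / (4 * n2) by rewrite divr_gt0 ?mulr_gt0.
(* The gain is [2 h sig], and [1 - |b|^2 >= 1 / 2] bounds [sig] from below by this root. *)
exists (2 * h * Num.sqrt (1 / (4 * n2))).
  by rewrite !mulr_gt0 // sqrtr_gt0.
move=> l b S gl b2 bM.
have [l' gl' l'E] := corrected_center r0 gl b2 bM.
pose sg (s : bool) := if s then h else - h.
have h4 : 0 < r - r / 4 - h by rewrite /h; lra.
have pick (p : J * bool) (S' : seq H) : exists2 x, dot x x = 1 /\
    (forall t, dot (T t x) x = offset l' (sg p.2) p.1.2 0 t) &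
    forall v, v \in S' -> far dot T x v.
  have gs : good dot T (r - r / 4 - h) (offset l' (sg p.2) p.1.2).
    apply: (good_near gl') => t; apply: le_trans (offset_dist _ _ _ _) _.
    by rewrite /sg; case: ifP; rewrite ?normrN gtr0_norm.
  have [x [x1 x2 x3]] := exact_value dot_norm M_ge0 T_le k_gt0 S' h4 gs.
  by exists x.
have [X [X1 X2 X3]] := far_family pick (b :: S).
(* Common coefficient of the [2 n2] far unit vectors, making [b + xx] a unit vector. *)
pose sig := Num.sqrt ((1 - nm b ^+ 2) / (2 * n2)).
have sig0 : 0 <= sig by exact: sqrtr_ge0.
have sig2 : sig ^+ 2 = (1 - nm b ^+ 2) / (2 * n2).
  by rewrite sqr_sqrtr // divr_ge0 ?mulr_ge0 ?ltW //; lra.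
pose xx := \sum_p sig%:C *: X p.
have csig : cmod sig%:C ^+ 2 = sig ^+ 2 by rewrite cmod_real ger0_norm.
have fx v : v \in b :: S -> far dot T xx v by move=> vS; apply: far_sum => p;
  exact: X2.
have fb := fx b (mem_head _ _); have [bx bTx] := far_sym fb.
have [xb xTb] := fb.
have Xxx p : dot (X p) xx = sig%:C.
  rewrite /xx (dot_far_member (F := id) (G := id) (fun=> sig%:C)) => [|i ip].
    by rewrite (X1 p).1 mulr1 conj_real.
  by rewrite eq_sym in ip; case: (X3 _ _ ip).
have TXxx t p : dot (T t (X p)) xx = sig%:C * offset l' (sg p.2) p.1.2 0 t.
  rewrite /xx (dot_far_member (F := T t) (G := id) (fun=> sig%:C)) => [|i ip].
    by rewrite (X1 p).2 conj_real.
  by rewrite eq_sym in ip; case: (X3 _ _ ip) => _ /(_ t) [].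
have TxxX t p : dot (T t xx) (X p) = sig%:C * offset l' (sg p.2) p.1.2 0 t.
  have -> : T t xx = \sum_p sig%:C *: T t (X p).
    by rewrite linear_sum; apply: eq_bigr => i _; rewrite linearZ.
  rewrite dotC (dot_far_member (F := id) (G := T t) (fun=> sig%:C)) => [|i ip].
    rewrite conjM -dotC (X1 p).2; congr (_ * _).
    by apply: etrans (conj_real _); congr (Num.conj _); exact: conj_real.
  by rewrite eq_sym in ip; case: (X3 _ _ ip) => _ /(_ t) [].
have c1 : 1 / 2 <= 1 - nm b ^+ 2 by lra.
(* Both vectors of a pair have inner product [sig] with [xx], so the difference is orthogonal to it;
   in the forms only the opposite offsets survive. *)
pose z (q : 'I_m) (j : 'I_k * bool) := X (q, j, true) - X (q, j, false).
have Xb p : far dot T (X p) b by apply: X2; exact: mem_head.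
have zb q j : far dot T (z q j) b by exact: farB.
have offsetB (q : 'I_m) (j : 'I_k * bool) t :
    sig%:C * offset l' (sg true) j 0 t - sig%:C * offset l' (sg false) j 0 t =
    (2 * h * sig)%:C * ((t == j.1)%:R * imunit R j.2).
  by rewrite !mxE /sg rmorphN !rmorphM /= rmorph_nat; ring.
exists (b + xx), z, (2 * h * sig); split.
- apply: ler_wpM2l; first by rewrite mulr_ge0 // ltW.
  apply: ler_wsqrtr.
  rewrite ler_pdivlMr ?mulr_gt0 //.
  by have -> : 1 / (4 * n2) * (2 * n2) = 1 / 2 by field; rewrite gt_eqF.
- split=> [|t].
    rewrite dotDl !dotDr xb bx addr0 add0r dotxx // (far_sum_norm (T := T)) //;
      last first.
      by move=> p; exact: (X1 p).1.
    rewrite -rmorphD /= (eq_bigr (fun=> sig ^+ 2)) => [|p _]; last exact: csig.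
    rewrite sumr_const card_prod card_bool -[_ *+ _]mulr_natr natrM -/n2 sig2.
    have -> : nm b ^+ 2 + (1 - nm b ^+ 2) / (2 * n2) * (n2 * 2) = 1.
      by field; rewrite gt_eqF.
    by [].
  rewrite [T t (_ + _)]linearD dotDl !dotDr (xTb t).1 (bTx t).1 addr0 add0r
    far_sum_form //.
  have -> : \sum_p (cmod sig%:C ^+ 2)%:C * dot (T t (X p)) (X p) =
      (sig ^+ 2 * (2 * n2))%:C * l' 0 t.
    have sumX : \sum_p dot (T t (X p)) (X p) = (2 * n2)%:C * l' 0 t.
      rewrite (eq_bigr (fun p => offset l' (sg p.2) p.1.2 0 t)); last first.
        by move=> p _; exact: (X1 p).2.
      rewrite sum_pair_bool (eq_bigr (fun=> 2 * l' 0 t)) => [|j _].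
        by rewrite sumr_const -[_ *+ _]mulr_natr rmorphM /= /n2 !rmorph_nat;
          ring.
      by rewrite !mxE /sg /= rmorphN; ring.
    by rewrite csig -mulr_sumr sumX mulrA -rmorphM.
  rewrite sig2 divfK ?gt_eqF ?mulr_gt0 // l'E; ring.
- by move=> v vS; rewrite addrC addKr; exact: fx.
- by move=> q j v vS; apply: farB; exact: X2.
split.
- by move=> q j; rewrite dotDr (zb q j).1 add0r dotBl !Xxx subrr.
- move=> q j; have Xn p : nm (X p) = 1 by apply: nm_unit => //; case: (X1 p).
  by rewrite (le_trans (nmD _ _)) // nmN !Xn.
- move=> q j q' j' qq.
  have n s s' : (q, j, s) != (q', j', s') :> J * bool by rewrite !xpair_eqE
    (negbTE qq).
  by rewrite dotBl !dotBr !(X3 _ _ (n _ _)).1 !subr0.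
- move=> q j t; rewrite dotDr ((zb q j).2 t).1 add0r /z [T t (_ - _)]linearB
    dotBl !TXxx.
  exact: offsetB.
- move=> q j t; rewrite [T t (_ + _)]linearD dotDl.
  rewrite ((far_sym (zb q j)).2 t).1 add0r dotBr !TxxX.
  exact: offsetB.
Qed.

End Step.

(** * Recursive choice depending on the whole past *)

Lemma history_choice (X : Type) (x0 : X) (P : nat -> (nat -> X) -> X -> Prop) :
  (forall n f g x, (forall i, (i < n)%N -> f i = g i) -> P n f x -> P n g x) ->
  (forall n f, (forall i, (i < n)%N -> P i f (f i)) -> exists x, P n f x) ->
  exists f, forall n, P n f (f n).
Proof.
move=> Pext Pex.
have [F FP] : {F : nat * (nat -> X) -> X & forall nf,
    (exists x, P nf.1 nf.2 x) -> P nf.1 nf.2 (F nf)}.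
  apply: (@choice _ _ (fun nf y => (exists x, P nf.1 nf.2 x) -> P nf.1 nf.2 y))
    => nf.
  have [[x hx]|h] := pselect (exists x, P nf.1 nf.2 x).
    by exists x.
  by exists x0.
(* The past is stored as a finite list, padded with [x0]; [P] sees only indices below [n], so the
   padding is harmless. *)
pose hist := fix hist n := if n is n'.+1 then
  rcons (hist n') (F (n', nth x0 (hist n'))) else [::].
have size_hist n : size (hist n) = n by elim: n => //= n ih;
  rewrite size_rcons ih.
pose f n := F (n, nth x0 (hist n)).
have histE n i : (i < n)%N -> nth x0 (hist n) i = f i.
  elim: n => // n ih; rewrite ltnS leq_eqVlt => /predU1P[->|lt] /=.
    by rewrite nth_rcons size_hist ltnn eqxx.
  by rewrite nth_rcons size_hist lt ih.
exists f => n; elim/ltn_ind: n => n ih.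
apply: (Pext n (nth x0 (hist n))); first exact: histE.
apply: (FP (n, _)); apply: Pex => i lt /=; rewrite histE //.
apply: (Pext i f); last exact: ih.
by move=> j ji; rewrite histE // (ltn_trans ji).
Qed.

(** * Prescribing two families of form values with handles *)

Section Handles.
Variables (R : realType) (H : completeNormedModType R[i]).
Variables (dot : {dot H for Num.conj}) (k : nat) (T : 'I_k -> {linear H -> H}).

(* <T z, u> = c and <T u, z> = d decouple into al + i be = c / w and
   al - i be = conj d / w, with al, be the coefficients of the two handles. *)
Lemma handle_solve (z : 'I_k * bool -> H) (u : H) (w w0 e : R) (c d : 'I_k ->
  R[i]) :
  0 < w0 -> w0 <= w -> (forall j, nm (z j) <= 2) ->
  (forall j t, dot (T t (z j)) u = w%:C * ((t == j.1)%:R * imunit R j.2)) ->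
  (forall j t, dot (T t u) (z j) = w%:C * ((t == j.1)%:R * imunit R j.2)) ->
  (forall t, cmod (c t) <= e) -> (forall t, cmod (d t) <= e) ->
  exists co : 'I_k * bool -> R[i],
  [/\ forall t, dot (T t (\sum_j co j *: z j)) u = c t,
      forall t, dot (T t u) (\sum_j co j *: z j) = d t &
      nm (\sum_j co j *: z j) <= 4 * k%:R / w0 * e].
Proof.
move=> w00 w0w z2 Tz Tu ce de.
have w_gt0 : 0 < w by exact: lt_le_trans w0w.
have wC : w%:C != 0 :> R[i] by rewrite fmorph_eq0 gt_eqF.
have iC : 'i%C != 0 :> R[i] by rewrite -cmod_eq0 cmod_i oner_eq0.
pose co (j : 'I_k * bool) : R[i] :=
  if j.2 then (c j.1 - Num.conj (d j.1)) / (2 * w%:C * 'i%C)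
  else (c j.1 + Num.conj (d j.1)) / (2 * w%:C).
have coe j : cmod (co j) <= e / w.
  have h2 (x y : R[i]) : cmod x <= e -> cmod y <= e ->
      (cmod x + cmod y) / (2 * w) <= e / w.
    move=> h1 h2; have -> : e / w = (e + e) / (2 * w) by field; rewrite gt_eqF.
    by rewrite ler_wpM2r ?lerD // invr_ge0 mulr_ge0 // ltW.
  have nc : cmod (Num.conj (d j.1)) <= e by rewrite cmod_conj.
  have n2w : cmod (2 * w%:C) = 2 * w.
    rewrite -[2](rmorph_nat (real_complex R)) -rmorphM cmod_real ger0_norm //.
    by rewrite mulr_ge0 // ltW.
  have i2w : 0 <= (2 * w)^-1 by rewrite invr_ge0 mulr_ge0 // ltW.
  rewrite /co; case: ifP => _; rewrite cmodM cmodV ?(cmodM _ 'i%C) ?cmod_i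
    ?mulr1 n2w;
    apply: le_trans (h2 _ _ (ce j.1) nc); rewrite ler_wpM2r //.
    exact: cmodBD.
  exact: cmodD.
exists co; split=> [t|t|].
- rewrite linear_sum dot_suml sum_pair_bool (bigD1 t) //= [X in _ + X]big1 =>
    [|j jt].
    rewrite !linearZ !dotZl !Tz /= eqxx /co /=; field; exact/andP.
  by rewrite !linearZ !dotZl !Tz /= eq_sym (negbTE jt) !mul0r !mulr0 addr0.
- rewrite dot_sumr sum_pair_bool (bigD1 t) //= [X in _ + X]big1 => [|j jt].
    rewrite !dotZr !Tu /= eqxx /co /=.
    have cV (x y : R[i]) : Num.conj (x / y) = Num.conj x / Num.conj y by
      rewrite rmorphM fmorphV.
    have c2 : Num.conj 2 = 2 :> R[i] by rewrite rmorph_nat.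
    have cB (x y : R[i]) : Num.conj (x - y) = Num.conj x - Num.conj y by
      rewrite rmorphB.
    have cD (x y : R[i]) : Num.conj (x + y) = Num.conj x + Num.conj y by
      rewrite rmorphD.
    rewrite !cV !conjM c2 conj_i conj_real cB cD !conjCK.
    by field; exact/andP.
  by rewrite !dotZr !Tu /= eq_sym (negbTE jt) !mul0r !mulr0 addr0.
- rewrite (le_trans (nm_sum _ _ _)) //.
  (* There are [2 k] handles of norm at most 2, with coefficients at most [e / w0]. *)
  apply: (@le_trans _ _ (\sum_(j : 'I_k * bool) e / w0 * 2)).
    apply: ler_sum => j _; rewrite nmZ ler_pM ?cmod_ge0 ?nm_ge0 //.
    rewrite (le_trans (coe j)) // ler_wpM2l //.
      exact: le_trans (cmod_ge0 _) (ce j.1).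
    by rewrite lef_pV2 ?posrE.
  rewrite sumr_const card_prod card_ord card_bool -[_ *+ _]mulr_natr natrM.
  by rewrite le_eqVlt; apply/orP; left; apply/eqP; field; rewrite gt_eqF.
Qed.

End Handles.

(** * Residuals off the span of an orthonormal sequence *)

Section Residual.
Variables (R : realType) (H : completeNormedModType R[i]).
Variable dot : {dot H for Num.conj}.
Hypothesis dot_norm : forall x, dot x x = `|x| ^+ 2.

Definition residual (n : nat) (u : nat -> H) (v : H) : H :=
  v - \sum_(i < n) dot v (u i) *: u i.

Lemma residualS n u v : residual n.+1 u v = residual n u v - dot v (u n) *: u n.
Proof. by rewrite /residual big_ord_recr opprD addrA. Qed.

Lemma residual_ext n u u' v : (forall i, (i < n)%N -> u i = u' i) ->
  residual n u v = residual n u' v.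
Proof. by move=> h; congr (_ - _); apply: eq_bigr => i _; rewrite h. Qed.

Lemma dot_residual n u v x :
  (forall i, (i < n)%N -> dot (u i) x = 0) -> dot (residual n u v) x = dot v x.
Proof.
by move=> h; rewrite dotBl dot_suml big1 ?subr0 // => i _;
  rewrite dotZl h ?mulr0.
Qed.

Lemma residual_orth n u v l :
  (forall i j, (i < n)%N -> (j < n)%N -> dot (u i) (u j) = (i == j)%:R) ->
  (l < n)%N -> dot (residual n u v) (u l) = 0.
Proof.
move=> ou ln; rewrite dotBl dot_suml (bigD1 (Ordinal ln)) //= big1 => [|i il].
  by rewrite dotZl ou // eqxx mulr1 addr0 subrr.
by rewrite dotZl ou // -[(i : nat) == l]/(i == Ordinal ln) (negbTE il) mulr0.
Qed.

Lemma dot_residualr n u v :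
  (forall i j, (i < n)%N -> (j < n)%N -> dot (u i) (u j) = (i == j)%:R) ->
  dot v (residual n u v) = (nm (residual n u v) ^+ 2)%:C.
Proof.
move=> ou; rewrite -(dotxx dot_norm) [in LHS](_ : dot v _ =
  dot (residual n u v + \sum_(i < n) dot v (u i) *: u i) (residual n u v));
  last by rewrite subrK.
rewrite dotDl [X in _ + X]dot_suml [X in _ + X]big1 ?addr0 // => i _.
by rewrite dotZl [dot (u i) _]dot_eq0C ?mulr0 // residual_orth.
Qed.

Lemma nm_residualS n u v : orthonormal_seq dot u ->
  nm (residual n.+1 u v) ^+ 2 = nm (residual n u v) ^+ 2 - cmod (dot v (u n))
    ^+ 2.
Proof.
move=> ou; apply: (@complexI R); rewrite rmorphB /= -!(dotxx dot_norm)
  residualS.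
have e : dot (residual n u v) (u n) = dot v (u n).
  by apply: dot_residual => i lt; rewrite ou ltn_eqF.
move: (residual n u v) e => res e; rewrite dotBl !dotBr !dotZl !dotZr e ou eqxx
  mulr1 [dot (u n) _]dotC e -mul_conj.
ring.
Qed.

(** The squared residual never increases. If it stayed above [e^2], each of infinitely many visits
    would lower it by at least [(c e)^2], making it negative in the end. *)
Lemma residual_small u v (c e : R) : orthonormal_seq dot u -> 0 < c -> 0 < e ->
  (forall N, exists2 n, (N <= n)%N &
     cmod (dot v (u n)) = c * nm (residual n u v)) ->
  exists n, nm (residual n u v) < e.
Proof.
move=> ou c0 e0 hv; apply: contrapT => /forallNP h.
have {}h n : e <= nm (residual n u v) by rewrite leNgt; apply/negP/h.
have mono N n : (N <= n)%N -> nm (residual n u v) ^+ 2 <= nm (residual N u v)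
  ^+ 2.
  elim: n => [|n ih]; first by rewrite leqn0 => /eqP ->.
  rewrite leq_eqVlt => /predU1P[-> //|/ih]; apply: le_trans.
  by rewrite nm_residualS // gerBl sqr_ge0.
have dec p : exists n, nm (residual n u v) ^+ 2 <= nm v ^+ 2 - p%:R * (c * e)
  ^+ 2.
  elim: p => [|p [N hN]].
    by exists 0%N; rewrite /residual big_ord0 subr0 mul0r subr0.
  have [n Nn hn] := hv N; exists n.+1; rewrite nm_residualS // hn.
  have h1 := mono _ _ Nn.
  have h2 : (c * e) ^+ 2 <= (c * nm (residual n u v)) ^+ 2.
    by rewrite ler_sqr ?nnegrE ?mulr_ge0 ?nm_ge0 ?(ltW c0) ?(ltW e0) //
      ler_wpM2l // ltW.
  rewrite -natr1 mulrDl; lra.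
have ce : 0 < (c * e) ^+ 2 by rewrite exprn_gt0 // mulr_gt0.
pose p := Num.bound (nm v ^+ 2 / (c * e) ^+ 2).
have : nm v ^+ 2 < p%:R * (c * e) ^+ 2.
  by rewrite -ltr_pdivrMr //; apply: archi_boundP; rewrite divr_ge0 // sqr_ge0.
have [n hn] := dec p; have := sqr_ge0 (nm (residual n u v)); lra.
Qed.

End Residual.

(** * The inductive construction of the basis *)

Section Construction.
Variables (R : realType) (H : completeNormedModType R[i]).
Variables (dot : {dot H for Num.conj}) (k : nat) (T : 'I_k -> {linear H -> H}).
Hypothesis dot_norm : forall x, dot x x = `|x| ^+ 2.
Variable M : R.
Hypothesis M_ge0 : 0 <= M.
Hypothesis T_le : forall t x, nm (T t x) <= M * nm x.
Variables (m : nat) (a : nat -> nat -> Cvec R k) (y : nat -> H) (w0 tau : R).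
Hypothesis w0_gt0 : 0 < w0.
Hypothesis tau_gt0 : 0 < tau.

(** If [|b| <= s] with [tau <= s], one handle correction adds at most [4 k / w0 (tau + M s)], so
    this factor bounds the growth of [s]. *)
Definition growth : R := 1 + 4 * k%:R / w0 * (1 + M).

Lemma growth_ge1 : 1 <= growth.
Proof. by rewrite lerDl mulr_ge0 ?addr_ge0 ?divr_ge0 ?(ltW w0_gt0). Qed.

Definition state := (H * ('I_m -> 'I_k * bool -> H))%type.
Implicit Types (f : nat -> state) (x : state).

Definition vec f (i : nat) : H := (f i).1.

(* The handles [x.2 q] of step n are reserved for prescribing the entries
   (n, n + 1 + q) and (n + 1 + q, n); until then every vector avoids them. *)
Record valid (n : nat) f x : Prop := Valid {
  valid_unit : dot x.1 x.1 = 1;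
  valid_diag : forall t, dot (T t x.1) x.1 = a n n 0 t;
  valid_orth : forall i, (i < n)%N -> dot x.1 (vec f i) = 0;
  valid_band : forall i t, (i < n <= i + m)%N ->
    dot (T t x.1) (vec f i) = a i n 0 t /\ dot (T t (vec f i)) x.1 = a n i 0 t;
  valid_avoid : forall i (q : 'I_m) j, (i < n < i.+1 + q)%N -> dot x.1 ((f i).2
    q j) = 0;
  valid_handle_orth : forall q j, dot (x.2 q j) x.1 = 0;
  valid_handle_norm : forall (q : 'I_m) j, nm (x.2 q j) <= 2;
  valid_handle_disjoint : forall q j q' j', q != q' -> dot (x.2 q j) (x.2 q'
    j') = 0;
  valid_gain : exists2 w, w0 <= w & forall q j t,
    dot (T t (x.2 q j)) x.1 = w%:C * ((t == j.1)%:R * imunit R j.2) /\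
    dot (T t x.1) (x.2 q j) = w%:C * ((t == j.1)%:R * imunit R j.2);
  valid_far : forall q j i, (i < n)%N -> far dot T (x.2 q j) (vec f i);
  valid_far_handle : forall q j i q' j', (i < n)%N ->
    far dot T (x.2 q j) ((f i).2 q' j');
  valid_target : forall q j l, (l <= n + m)%N -> dot (x.2 q j) (y l) = 0;
  valid_progress : cmod (dot (y n) x.1) = tau * nm (residual dot n (vec f) (y
    n)) }.

Lemma valid_ext n f g x : (forall i, (i < n)%N -> f i = g i) ->
  valid n f x -> valid n g x.
Proof.
move=> fg.
have vfg i : (i < n)%N -> vec g i = vec f i by move=> lt; rewrite /vec fg.
case=> v1 v2 v3 v4 v5 v6 v7 v8 v9 v10 v11 v12 v13; split=> //.
- by move=> i lt; rewrite vfg // v3.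
- by move=> i t h; rewrite vfg; [exact: v4|case/andP: h].
- by move=> i q j h; rewrite -fg; [exact: v5|case/andP: h].
- by move=> q j i lt; rewrite vfg //; exact: v10.
- by move=> q j i q' j' lt; rewrite -fg //; exact: v11.
- by rewrite v13; congr (_ * nm _); apply: residual_ext => i lt; rewrite vfg.
Qed.

Section Next.
Variables (n : nat) (f : nat -> state).
Hypothesis fP : forall i, (i < n)%N -> valid i f (f i).
Hypothesis a_small : forall i t, (i < n <= i + m)%N ->
  cmod (a i n 0 t) <= tau /\ cmod (a n i 0 t) <= tau.

Lemma past_orthonormal i j : (i < n)%N -> (j < n)%N ->
  dot (vec f i) (vec f j) = (i == j)%:R.
Proof.
move=> hi hj; have [lt|lt|->] := ltngtP i j.
- exact/dot_eq0C/(valid_orth (fP hj)).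
- exact: (valid_orth (fP hi)).
- exact: (valid_unit (fP hj)).
Qed.

(** Vectors older than the handle were avoided when it was made; later ones avoid it until the step
    it is reserved for. *)
Lemma past_handle_orth i l (q : 'I_m) j : (i < n)%N -> (l < n)%N -> (l < i.+1 +
  q)%N ->
  dot ((f i).2 q j) (vec f l) = 0.
Proof.
move=> hi hl lq; have [lt|lt|->] := ltngtP l i.
- exact: (valid_far (fP hi) _ _ lt).1.
- by apply: dot_eq0C; apply: (valid_avoid (fP hl)); rewrite lt.
- exact: (valid_handle_orth (fP hi)).
Qed.

Lemma past_handle_disjoint i l (q : 'I_m) j (q' : 'I_m) j' : (i < n)%N -> (l <
  n)%N ->
  (i.+1 + q = n)%N -> (n < l.+1 + q')%N -> dot ((f i).2 q j) ((f l).2 q' j') =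
    0.
Proof.
move=> hi hl qn q'n; have [lt|lt|il] := ltngtP l i.
- exact: (valid_far_handle (fP hi) _ _ _ _ lt).1.
- exact/dot_eq0C/(valid_far_handle (fP hl) _ _ _ _ lt).1.
- subst l; apply: (valid_handle_disjoint (fP hi)); apply: contraTneq q'n => <-.
  by rewrite -qn ltnn.
Qed.

(** Induction on the number of past vectors treated. The handles of step [i] are far from all
    earlier vectors, so a correction keeps the entries already set: the system is triangular. The
    exponent bounds the number of corrections made so far. *)
Lemma partial_correction i : (i <= n)%N -> exists b,
  [/\ forall l, (l < n)%N -> dot b (vec f l) = 0,
      forall l (q : 'I_m) j, (l < n < l.+1 + q)%N -> dot b ((f l).2 q j) = 0,
      dot (y n) b = (tau * nm (residual dot n (vec f) (y n)))%:C,
      forall l t, (l < i)%N -> (n <= l + m)%N ->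
        dot (T t b) (vec f l) = a l n 0 t /\ dot (T t (vec f l)) b = a n l 0 t &
      nm b <= tau * growth ^+ (i + m - n)].
Proof.
elim: i => [_|i ih lt].
  set res := residual dot n (vec f) (y n).
  (* For a zero residual the quotient is 0 by convention and the claims still hold. *)
  exists ((tau / nm res)%:C *: res); split=> //.
  - by move=> l hl; rewrite dotZl residual_orth ?mulr0 //;
      exact: past_orthonormal.
  - move=> l q j /andP[hl hq]; rewrite dotZl dot_residual => [|i hi].
      rewrite [dot _ _]dot_eq0C ?mulr0 //; apply: (valid_target (fP hl)).
      by have := ltn_ord q; lia.
    by apply: dot_eq0C; apply: past_handle_orth; rewrite // (ltn_trans hi).
  - rewrite dotZr conj_real dot_residualr //; last exact: past_orthonormal.
    rewrite -rmorphM -/res; congr _%:C; have [->|r0] := eqVneq (nm res) 0.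
      by rewrite expr0n !mulr0.
    by field.
  - rewrite nmZ cmod_real; have [->|r0] := eqVneq (nm res) 0.
      by rewrite mulr0 mulr_ge0 ?exprn_ge0 ?(le_trans _ growth_ge1) ?ltW.
    rewrite ger0_norm ?divr_ge0 ?nm_ge0 ?(ltW tau_gt0) // divfK //
      -[leLHS]mulr1.
    by rewrite ler_wpM2l ?exprn_ege1 ?growth_ge1 // ltW.
have [b [b1 b2 b3 b4 b5]] := ih (ltnW lt).
(* Outside the band nothing is prescribed against vector [i], and [b] is kept. *)
have [nim|nim] := leqP n (i + m); last first.
  exists b; split=> // [l t|].
    by rewrite ltnS leq_eqVlt => /predU1P[->|]; [rewrite leqNgt nim|exact: b4].
  by apply: le_trans b5 _; rewrite (_ : i + m - n = i.+1 + m - n)%N //; lia.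
have qm : (n - i.+1 < m)%N by lia.
(* The handles that step [i] reserved for step [n]. *)
pose q := Ordinal qm; have qn : (i.+1 + q = n)%N by rewrite /=; lia.
have [w w0w hw] := valid_gain (fP lt).
have u1 : nm (vec f i) = 1 by apply: nm_unit; rewrite // (valid_unit (fP lt)).
have [||co [s1 s2 s3]] := @handle_solve R H dot k T ((f i).2 q) (vec f i) w w0
  (tau + M * nm b) (fun t => a i n 0 t - dot (T t b) (vec f i))
  (fun t => a n i 0 t - dot (T t (vec f i)) b) w0_gt0 w0w
  (valid_handle_norm (fP lt) q) (fun j t => (hw q j t).1) (fun j t => (hw q j
    t).2).
- move=> t; rewrite (le_trans (cmodBD _ _)) // lerD //.
    by case: (@a_small i t); rewrite ?lt.
  by rewrite (le_trans (form_le dot_norm T_le _ _ _)) // u1 mulr1.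
- move=> t; rewrite (le_trans (cmodBD _ _)) // lerD //.
    by case: (@a_small i t); rewrite ?lt.
  by rewrite (le_trans (form_le dot_norm T_le _ _ _)) // u1 mulr1.
set zeta := \sum_j co j *: (f i).2 q j in s1 s2 s3.
have zeta_far l : (l < i)%N -> far dot T zeta (vec f l).
  by move=> li; apply: far_sum => j; exact: (valid_far (fP lt)).
have zeta_orth v : (forall j, dot ((f i).2 q j) v = 0) -> dot zeta v = 0.
  by move=> h; rewrite dot_suml big1 // => j _; rewrite dotZl h mulr0.
exists (b + zeta); split.
- move=> l hl; rewrite dotDl b1 // add0r zeta_orth // => j.
  by apply: past_handle_orth; rewrite // qn.
- move=> l q' j' hlq; rewrite dotDl b2 // add0r zeta_orth // => j.
  by case/andP: hlq => ? ?; exact: past_handle_disjoint.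
- rewrite dotDr b3 [dot _ zeta]dot_eq0C ?addr0 //; apply: zeta_orth => j.
  exact: (valid_target (fP lt)).
- move=> l t; rewrite [T t (b + _)]linearD dotDl dotDr.
  rewrite ltnS leq_eqVlt => /predU1P[->|li] h.
    by rewrite s1 s2 !subrKC.
  have [z1 /(_ t) [z2 z3]] := zeta_far _ li; have [-> ->] := b4 l t li h.
  by rewrite z2 [dot _ zeta]dot_eq0C // !addr0.
rewrite (le_trans (nmD _ _)) // (_ : i.+1 + m - n = (i + m - n).+1)%N; last lia.
set e := (i + m - n)%N in b5 *.
have g1 : 1 <= growth ^+ e by rewrite exprn_ege1 ?growth_ge1.
have te : tau <= tau * growth ^+ e by rewrite -[leLHS]mulr1 ler_wpM2l // ltW.
have c0 : 0 <= 4 * k%:R / w0 by rewrite divr_ge0 ?mulr_ge0 ?(ltW w0_gt0).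
rewrite exprS mulrCA {1}/growth.
move: (4 * k%:R / w0) c0 s3 => c c0 s3; rewrite mulrDl mul1r lerD // (le_trans
  s3) //.
by rewrite -mulrA ler_wpM2l // mulrDl mul1r lerD // ler_wpM2l.
Qed.

Variables (r : R).
Hypothesis stepP : extendable dot T M m r w0.
Hypothesis a_good : good dot T r (a n n).
Hypothesis tau_half : (tau * growth ^+ m) ^+ 2 <= 1 / 2.
Hypothesis tau_r : 16 * M * (tau * growth ^+ m) ^+ 2 <= r.

Lemma valid_next : exists x, valid n f x.
Proof.
have [b [b1 b2 b3 b4 b5]] := partial_correction (leqnn n).
rewrite addKn in b5.
have b52 : nm b ^+ 2 <= (tau * growth ^+ m) ^+ 2.
  by rewrite ler_sqr ?nnegrE ?nm_ge0 // (le_trans (nm_ge0 _) b5).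
(* All past vectors, all past handles, and the targets up to [n + m], the last step that uses the
   new handles. *)
pose S := [seq vec f i | i <- iota 0 n] ++
  [seq (f p.1).2 p.2.1 p.2.2 | p <- [seq (i, p) | i <- iota 0 n, p <- enum {:
    'I_m * ('I_k * bool)}]]
  ++ [seq y l | l <- iota 0 (n + m).+1].
have Su i : (i < n)%N -> vec f i \in b :: S.
  by move=> lt; rewrite inE mem_cat map_f ?orbT // mem_iota.
have Sz i q j : (i < n)%N -> (f i).2 q j \in b :: S.
  move=> lt; rewrite inE !mem_cat; apply/orP; right; apply/orP; right;
    apply/orP; left.
  apply/mapP; exists (i, (q, j)) => //; apply/allpairsP; exists (i, (q, j)).
  by rewrite mem_iota mem_enum.
have Sy l : (l <= n + m)%N -> y l \in b :: S.
  by move=> lt; rewrite inE !mem_cat [_ \in map y _]map_f ?orbT // mem_iota.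
have [||u [z [w [w0w [u1 uT] ufar zfar [z1 z2 z3 z4 z5]]]]] := stepP S a_good
  (b := b).
- exact: le_trans tau_half.
- by apply: le_trans tau_r; rewrite ler_wpM2l ?mulr_ge0.
(* The far part of [u] is invisible to the past, so the relations arranged for [b] pass to [u]. *)
have dub v : v \in b :: S -> dot u v = dot b v.
  by move=> /ufar [h _]; apply/eqP; rewrite -subr_eq0 -dotBl h.
exists (u, z); split=> //=.
- by move=> i lt; rewrite dub ?Su // b1.
- move=> i t /andP[lt nim]; have [_ /(_ t) [h1 h2]] := ufar _ (Su _ lt).
  have [<- <-] := b4 i t lt nim; split; apply/eqP; rewrite -subr_eq0.
    by rewrite -dotBl -linearB h1.
  by rewrite -dotBr dot_eq0C.
- by move=> i q j /andP[lt h]; rewrite dub ?Sz // b2 // lt.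
- by exists w.
- by move=> q j i lt; apply: zfar; exact: Su.
- by move=> q j i q' j' lt; apply: zfar; exact: Sz.
- by move=> q j l lt; case: (zfar q j _ (Sy _ lt)).
- rewrite dotC cmod_conj dub ?Sy ?leq_addr // dotC cmod_conj b3 cmod_real
    ger0_norm //.
  by rewrite mulr_ge0 ?nm_ge0 // ltW.
Qed.

End Next.
End Construction.

(** * Completeness of the orthonormal sequence *)

Section Density.
Variables (R : realType) (H : completeNormedModType R[i]).
Variable dot : {dot H for Num.conj}.

Lemma residual_span_dense (u : nat -> H) (D : set H) : dense D ->
  (forall v e, D v -> 0 < e -> exists n, nm (residual dot n u v) < e) ->
  closure (lin_span u) = setT.
Proof.
move=> dD hD; apply/seteqP; split=> // x _ U /nbhs_ballP [e /= e0 xU].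
have eE : e = (complex.Re e)%:C by rewrite RRe_real // gtr0_real.
have e'0 : 0 < complex.Re e by rewrite -ltcR -eE.
have e2 : 0 < (complex.Re e / 2)%:C :> R[i] by rewrite ltcR divr_gt0.
have [v [xv Dv]] : (ball x (complex.Re e / 2)%:C `&` D) !=set0.
  apply: dD; last exact: ball_open.
  by exists x; exact: ballxx.
have [n hn] := hD v (complex.Re e / 2) Dv (divr_gt0 e'0 (ltr0n _ 2)).
exists (\sum_(i < n) dot v (u i) *: u i); split;
  first by exists n, (fun i => dot v (u i)).
apply: xU; rewrite -ball_normE /= -(subrK v x) -addrA eE.
apply: le_lt_trans (ler_normD _ _) _.
rewrite [complex.Re e]splitr rmorphD /=; apply: ltrD.
  by move: xv; rewrite -ball_normE.
by rewrite norm_nm ltcR.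
Qed.

Lemma recurrent_sequence (D : set H) : countable D -> dense D ->
  exists y : nat -> H, forall v, D v -> forall N, exists2 n, (N <= n)%N & y n =
    v.
Proof.
move=> cD dD; have [v0 [_ Dv0]] : (setT `&` D) !=set0.
  by apply: dD; [exists 0|exact: openT].
have [e he] : exists e : nat -> H, forall v, D v -> exists i, e i = v.
  have [D0|[g]] := pfcard_geP cD; first by rewrite D0 in Dv0.
  by exists g => v /(@surj _ _ _ _ g) [i _ <-]; exists i.
(* The 2-adic valuation takes each value [i] infinitely often, namely at all [2^i (2 N + 1)]. *)
exists (fun n => e (logn 2 n)) => v /he [i <-] N.
exists (2 ^ i * (2 * N).+1)%N.
  by rewrite (leq_trans _ (leq_pmull _ _)) ?expn_gt0 //; lia.
by rewrite lognM ?expn_gt0 // pfactorK // (@logn_coprime 2) ?addn0 // coprime2n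
  /= oddM.
Qed.

End Density.

(** * A common bound for the operators *)

Section Bounded.
Variables (R : realType) (H : completeNormedModType R[i]) (k : nat).
Variable T : 'I_k -> {linear H -> H}.

Lemma uniform_bound : (forall t, bounded_near (T t) (nbhs (0 : H))) ->
  exists2 M : R, 0 <= M & forall t x, nm (T t x) <= M * nm x.
Proof.
move=> bT; have h t : exists M : R, 0 <= M /\ forall x, nm (T t x) <= M * nm x.
  have /linear_boundedP /pinfty_ex_gt0 [c c0 hc] := bT t.
  have cE : c = (complex.Re c)%:C by rewrite RRe_real // gtr0_real.
  exists (complex.Re c); split=> [|x]; first by rewrite -lecR -cE ltW.
  by rewrite -lecR rmorphM /= -cE -!norm_nm.
have [M hM] := choice h; exists (\sum_t M t) => [|t x].
  by apply: sumr_ge0 => t _; case: (hM t).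
rewrite (le_trans ((hM t).2 x)) // ler_wpM2r ?nm_ge0 // (bigD1 t) //= lerDl.
by apply: sumr_ge0 => t' _; case: (hM t').
Qed.

End Bounded.

(** * Choice of the constants and conclusion *)

Lemma cmod_le_sup_norm (R : realType) (k : nat) (l : Cvec R k) t :
  cmod (l 0 t) <= sup_norm l.
Proof. exact: (le_bigmax _ (fun t => cmod (l 0 t))). Qed.

Lemma dist_window (i n m : nat) : (i < n)%N -> (`|i - n| <= m)%N = (n <= i +
  m)%N.
Proof. by move=> lt; rewrite (distnEr (ltnW lt)) leq_subLR. Qed.

Unset Implicit Arguments.

Theorem corollary1p6
  (R : realType) (H : completeNormedModType R[i]) (dot : {dot H for Num.conj})
  (dot_norm : forall x : H, dot x x = `|x| ^+ 2)
  (H_separable : separable H) (H_infinite : infinite_dimensional H)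
  (k : nat) (k_gt0 : (0 < k)%N)
  (T : 'I_k -> {linear H -> H})
  (T_bounded : forall t : 'I_k, bounded_near (T t) (nbhs (0 : H)))
  (int_neq0 : interior (ess_num_range dot T) !=set0)
  (eps : R) (eps_gt0 : 0 < eps) (m : nat) (m_gt0 : (0 < m)%N) :
  exists2 delta : R, 0 < delta &
    forall a : nat -> nat -> Cvec R k,
      (forall n : nat,
         interior (ess_num_range dot T) (a n n) /\
         (eps%:E < set_dist (a n n) (boundary (ess_num_range dot T)))%E) ->
      (ereal_sup [set r : \bar R | exists n j : nat,
          (1 <= `|n - j| <= m)%N /\ r = (sup_norm (a n j))%:E]
        <= delta%:E)%E ->
      exists2 u : nat -> H, orthonormal_basis dot u &
        forall n j : nat, (`|n - j| <= m)%N ->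
          tuple_dot dot T (u j) (u n) = a n j.
Proof.
have [M M0 TM] := uniform_bound T_bounded.
(* Compensates the factor [k] between the maximum norm and the Euclidean distance. *)
pose r := eps / k%:R.
have r0 : 0 < r by rewrite divr_gt0 // ltr0n.
have [w0 w00 ext] := extendable_ex dot_norm M0 TM k_gt0 m_gt0 r0.
pose K := growth k M w0.
have K1 : 1 <= K by exact: growth_ge1.
have Km : 0 < K ^+ m by rewrite exprn_gt0 // (lt_le_trans ltr01).
have M1 : 0 < 16 * M + 1 by rewrite ltr_wpDl ?mulr_ge0.
(* Bound for all small parts [b]; as [beta^2 <= beta], it yields both smallness conditions of
   [extendable]. *)
pose beta := Num.min (1 / 2) (r / (16 * M + 1)).
have beta0 : 0 < beta by rewrite lt_min (divr_gt0 r0 M1) andbT divr_gt0.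
have beta2 : beta <= 1 / 2 by rewrite ge_min lexx.
have betar : beta * (16 * M + 1) <= r by rewrite -ler_pdivlMr // ge_min lexx
  orbT.
(* Used both as the bound on off-diagonal entries and as the proportion [tau] of the residual put
   into each vector; at most [m] corrections enlarge it to [beta]. *)
pose delta := beta / K ^+ m.
have delta0 : 0 < delta by rewrite divr_gt0.
have deltaK : delta * K ^+ m = beta by rewrite divfK ?gt_eqF.
have bb : beta ^+ 2 <= beta by nra.
exists delta => // a a_diag a_sup.
have a_small (n j : nat) t : (1 <= `|n - j| <= m)%N -> cmod (a n j 0 t) <=
  delta.
  move=> nj; apply: le_trans (cmod_le_sup_norm _ _) _; rewrite -lee_fin.
  by apply: le_trans a_sup; apply: ereal_sup_ubound; exists n, j.
have a_good n : good dot T r (a n n).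
  have [an dn] := a_diag n => mu; apply: ball_sub_of_dist_boundary an dn _.
  by rewrite /r mulrC divfK // pnatr_eq0 -lt0n.
have [D cD dD] := H_separable; have [y hy] := recurrent_sequence cD dD.
have [f fP] : exists f : nat -> state H k m,
    forall n, valid dot T a y w0 delta n f (f n).
  apply: (history_choice (0, fun _ _ => 0)) => [n f g x|n f fP];
    first exact: valid_ext.
  apply: (valid_next dot_norm M0 TM w00 delta0 fP _ ext) => //.
  - move=> i t /andP[lt nim]; have d0 : (0 < `|i - n|)%N.
      by rewrite (distnEr (ltnW lt)) subn_gt0.
    split; apply: a_small; first by rewrite d0 dist_window.
    by rewrite distnC d0 dist_window.
  - by rewrite deltaK; nra.
  - rewrite deltaK; nra.
have past n i : (i < n)%N -> valid dot T a y w0 delta i f (f i) by [].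
have ou : orthonormal_seq dot (vec f).
  move=> n j; apply: (past_orthonormal (past (maxn n j).+1)); rewrite ltnS.
    exact: leq_maxl.
  exact: leq_maxr.
exists (vec f).
  split=> //; apply: residual_span_dense dD _ => v e Dv e0.
  apply: residual_small ou delta0 e0 _ => // N; have [n Nn <-] := hy v Dv N.
  by exists n => //; exact: valid_progress (fP n).
move=> n j nj; apply/rowP => t; rewrite mxE.
(* An off-diagonal entry was secured at the later of its two steps. *)
have [lt|lt|->] := ltngtP n j.
- have h : (n < j <= n + m)%N by rewrite lt -dist_window.
  by case: (valid_band (fP j) t h).
- have h : (j < n <= j + m)%N by rewrite lt -dist_window // distnC.
  by case: (valid_band (fP n) t h).
- exact: (valid_diag (fP j)).
Qed.
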